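(* For every positive integer $r$ there is an $m_0$ such that for all integers $m\geq m_0$ and $n$ with $m\geq n\geq r$, $$\chi(\mathrm{KG}(K_{m,n},rK_2))=\zeta(\mathrm{KG}(K_{m,n},rK_2))=m(n-r+1).$$
   Context: All graphs and hypergraphs are finite and simple; $\chi$ is the chromatic number. $K_{m,n}$ is the complete bipartite graph with parts of sizes $m$ and $n$, and $rK_2$ is a matching of size $r$. $\mathrm{KG}(G,rK_2)$ is the graph whose vertices are all matchings of size $r$ in $G$ (subgraphs isomorphic to $rK_2$), two being adjacent if they are edge-disjoint. Altermatic number: for $X\in\{-1,0,+1\}^N$, $alt(X)$ is the length of a longest subsequence of nonzero terms of $X$ in which any two consecutive terms are different ($alt(0)=0$). For a hypergraph $\mathcal{H}$ (hyperedges are nonempty sets) with $|V(\mathcal{H})|=N$ and a linear ordering $\sigma=(\sigma(1),\ldots,\sigma(N))$ of $V(\mathcal{H})$, put $X^+_\sigma=\{\sigma(j): x_j=+1\}$ and $X^-_\sigma=\{\sigma(j): x_j=-1\}$. $alt_\sigma(\mathcal{H})$ is the largest $k$ for which there is an $X\in\{-1,0,+1\}^N$ with $alt(X)=k$ such that neither $X^+_\sigma$ nor $X^-_\sigma$ contains a hyperedge of $\mathcal{H}$; $alt(\mathcal{H})=\min_\sigma alt_\sigma(\mathcal{H})$. $\mathrm{KG}(\mathcal{H})$ is the graph whose vertices are the hyperedges of $\mathcal{H}$, two being adjacent if they are disjoint. The altermatic number of a graph $F$ is $\zeta(F)=\max_{\mathcal{H}}\{|V(\mathcal{H})|-alt(\mathcal{H})\}$,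 over all hypergraphs $\mathcal{H}$ such that $\mathrm{KG}(\mathcal{H})$ and $F$ are homomorphically equivalent (there are graph homomorphisms in both directions). *)

(* Defs.v *)
From mathcomp Require Import all_boot.

Set Implicit Arguments.
Unset Strict Implicit.
Unset Printing Implicit Defensive.

Record sgraph := SGraph {
  vertex :> finType;
  adj : rel vertex;
  adj_sym : symmetric adj;
  adj_irrefl : irreflexive adj }.

Definition colorable (G : sgraph) (k : nat) : bool :=
  [exists c : {ffun G -> 'I_k}, forall x, forall y, adj x y ==> (c x != c y)].

Lemma colorable_exists (G : sgraph) : exists k, colorable G k.
Proof.
exists #|G|; apply/existsP; exists [ffun x => enum_rank x].
apply/forallP=> x; apply/forallP=> y; apply/implyP=> xy.
rewrite !ffunE (inj_eq enum_rank_inj); apply: contraTneq xy => ->.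
by rewrite adj_irrefl.
Qed.

Definition chromatic_number (G : sgraph) : nat := ex_minn (colorable_exists G).

Definition has_hom (F G : sgraph) : Prop :=
  exists f : F -> G, forall x y, adj x y -> adj (f x) (f y).

Definition hom_equiv (F G : sgraph) : Prop := has_hom F G /\ has_hom G F.

Definition complete_bipartite_adj (m n : nat) : rel ('I_m + 'I_n) :=
  fun x y => is_inl x != is_inl y.

Lemma complete_bipartite_sym m n : symmetric (@complete_bipartite_adj m n).
Proof. by move=> x y; rewrite /complete_bipartite_adj eq_sym. Qed.

Lemma complete_bipartite_irrefl m n :
  irreflexive (@complete_bipartite_adj m n).
Proof. by move=> x; rewrite /complete_bipartite_adj eqxx. Qed.

Definition complete_bipartite (m n : nat) : sgraph :=
  SGraph (@complete_bipartite_sym m n) (@complete_bipartite_irrefl m n).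

Definition edges (G : sgraph) : {set {set G}} :=
  [set e | [exists x, exists y, adj x y && (e == [set x; y])]].

(** A subgraph isomorphic to [r K_2] is given by its edge set. *)
Definition matchings (G : sgraph) (r : nat) : {set {set {set G}}} :=
  [set M : {set {set G}} | [&& M \subset edges G, trivIset M & #|M| == r]].

(** The condition [A != B] only matters when [set0 \in E]: any other set is
    not disjoint from itself. *)
Definition kneser_adj (T : finType) (E : {set {set T}}) :
    rel {A : {set T} | A \in E} :=
  fun A B => (A != B) && [disjoint val A & val B].

Lemma kneser_sym (T : finType) (E : {set {set T}}) : symmetric (@kneser_adj T E).
Proof. by move=> A B; rewrite /kneser_adj eq_sym disjoint_sym. Qed.

Lemma kneser_irrefl (T : finType) (E : {set {set T}}) :
  irreflexive (@kneser_adj T E).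
Proof. by move=> A; rewrite /kneser_adj eqxx. Qed.

Definition kneser (T : finType) (E : {set {set T}}) : sgraph :=
  SGraph (@kneser_sym T E) (@kneser_irrefl T E).

(** [KG(G, r K_2)]: matchings are sets of edges, so disjointness of two
    vertices is edge-disjointness. *)
Definition matching_kneser (G : sgraph) (r : nat) : sgraph :=
  kneser (matchings G r).

Record hypergraph := Hypergraph {
  hvertex :> finType;
  hyperedges : {set {set hvertex}};
  hyperedges_nonempty : set0 \notin hyperedges }.

Definition KG (H : hypergraph) : sgraph := kneser (hyperedges H).

(** Signs: [Some true] is +1, [Some false] is -1 and [None] is 0. *)
Definition sign := option bool.

Definition alternating (s : seq sign) : bool :=
  all isSome s && sorted (fun a b => a != b) s.

(** The sequences [mask b X] are exactly the subsequences of [X]. *)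
Definition alt (N : nat) (X : N.-tuple sign) : nat :=
  \max_(b : N.-tuple bool | alternating (mask b X)) size (mask b X).

(** A linear ordering of [T] is a duplicate-free tuple of length [#|T|]. *)
Definition sign_class (T : finType) (sigma : #|T|.-tuple T)
    (X : #|T|.-tuple sign) (a : sign) : {set T} :=
  [set tnth sigma j | j : 'I_#|T| & tnth X j == a].

Definition contains_hyperedge (H : hypergraph) (A : {set H}) : bool :=
  [exists e in hyperedges H, e \subset A].

(** The zero vector is always admissible, hyperedges being nonempty. *)
Definition alt_ord (H : hypergraph) (sigma : #|H|.-tuple H) : nat :=
  \max_(X : #|H|.-tuple sign |
      ~~ contains_hyperedge (sign_class sigma X (Some true)) &&
      ~~ contains_hyperedge (sign_class sigma X (Some false))) alt X.

(** The default value [#|H|] is harmless: [alt X <= #|H|] for every [X], and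
    there is at least one ordering. *)
Definition alt_hyp (H : hypergraph) : nat :=
  \big[minn/#|H|]_(sigma : #|H|.-tuple H | uniq sigma) alt_ord sigma.

(** [z] is the maximum of [|V(H)| - alt(H)] over all finite hypergraphs [H]
    with [KG(H)] homomorphically equivalent to [F]; the subtraction is never
    truncated, as [alt_hyp H <= #|H|]. *)
Definition is_altermatic_number (F : sgraph) (z : nat) : Prop :=
  (exists H : hypergraph, hom_equiv (KG H) F /\ #|H| - alt_hyp H = z) /\
  (forall H : hypergraph, hom_equiv (KG H) F -> #|H| - alt_hyp H <= z).

(* Main.v *)
Require Import Defs.
From mathcomp Require Import all_boot.
From mathcomp Require Import fingroup perm zify.

(** Choosing [r - 1] vertices of the side of size [n], every [r]-matching has
    an edge that avoids them; sending a matching to such an edge is a proper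
    colouring of the Kneser graph with [m * (n - r + 1)] colours.

    Both lower bounds come from one topological fact, [chromatic_bound]: for
    every hypergraph [H] and every linear ordering [sigma] of its vertices,
    [|V(H)| - alt_sigma(H)] is at most the chromatic number of [KG H].  It
    follows from the octahedral Tucker lemma [octahedral_tucker], which is
    obtained by Ky Fan's parity count of the maximal chains of sign vectors
    whose labels alternate in sign.  Homomorphisms transport colourings, so the
    altermatic number never exceeds the chromatic number, and it remains to
    exhibit one ordering of the [m * n] edges of [K_{m,n}] with
    [alt_sigma <= (r - 1) * m].

    View the edges as the cells of an [m] by [n] grid; matchings are the sets
    of cells with distinct rows and distinct columns.  Take an alternating
    sequence of signed cells with no [r]-matching of a single sign.  By Konig's
    theorem ([konig]) the cells of each sign lie on [r - 1] lines, a line being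
    a row or a column.  Split the rows and the columns into halves; read the
    two diagonal quadrants row by row and the other two column by column,
    each line in the direction opposite to the one before ([snake]).
    A line that covers both signs may contribute each of its at most [m]
    cells.  A line that covers one sign only contributes [O(r)] terms in the
    quadrant where it is read lengthwise, since two terms of its sign must be
    separated by one of the other sign, and at most one term for each crossing
    in the other quadrant; this is about [m / 2] in all.  As each sign has
    [r - 1] lines, the total is at most [(r - 1) * m + O(r ^ 2)], and exactly
    [(r - 1) * m] if both signs have the same lines.

    Otherwise the change of direction gains a term for every two consecutive
    lines ([turn_bound]): they meet the crossing lines in palindromic order, so
    if all crossings were used, the two crossings with a one-signed line would
    be an odd number of steps apart and carry opposite signs.  This gain is
    about [m / 4] if a line of length [m] is one-signed.  If all one-signed
    lines have length [n], it is about [n / 4], and moreover such a line only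
    contributes about [n / 2] terms instead of [m / 2].  In both cases the gain
    absorbs the [O(r ^ 2)] error once [m] is large ([grid_arith]). *)

Set Implicit Arguments.
Unset Strict Implicit.
Unset Printing Implicit Defensive.

(** * Alternating label lists *)

Definition del (T : Type) (i : nat) (s : seq T) := take i s ++ drop i.+1 s.

Lemma del_subseq (T : eqType) i (s : seq T) : subseq (del i s) s.
Proof.
rewrite -{2}(cat_take_drop i s); apply: cat_subseq => //.
by rewrite -addn1 addnC -drop_drop drop_subseq.
Qed.

Lemma map_del (T U : Type) (f : T -> U) i s : map f (del i s) = del i (map f s).
Proof. by rewrite /del map_cat map_take map_drop. Qed.

Lemma perm_rem_nth (T : eqType) (x0 : T) i s :
  i < size s -> perm_eq (rem (nth x0 s i) s) (del i s).
Proof.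
move=> i_s; rewrite -(perm_cons (nth x0 s i)).
apply: (@perm_trans _ s).
  by rewrite perm_sym; apply: perm_to_rem; rewrite mem_nth.
rewrite -{1}(cat_take_drop i s) (drop_nth x0 i_s) perm_sym.
by rewrite /del -cat1s perm_catCA.
Qed.

Lemma perm_rem (T : eqType) (x : T) s t :
  perm_eq s t -> perm_eq (rem x s) (rem x t).
Proof.
move=> st; have [xs|xs] := boolP (x \in s); last first.
  by rewrite !rem_id -?(perm_mem st).
rewrite -(perm_cons x) -(permPl (perm_to_rem xs)) (permPl st).
by apply: perm_to_rem; rewrite -(perm_mem st).
Qed.

Notation neqb := (fun a b : bool => a != b).

(** Deleting one letter makes a non-alternating word alternating, with a given
    first letter, in zero or two ways; an alternating word stays alternating by
    losing its first or its last letter, and exactly one of these two deletions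
    leaves the prescribed first letter. *)
Lemma sum_del_path (b : bool) (w : seq bool) :
  \big[addb/false]_(i < size w) path neqb b (del i w)
    = path neqb b w (+) path neqb (~~ b) w.
Proof.
elim: w b => [|a w IHw] b; first by rewrite big_ord0.
rewrite big_ord_recl /= /del /= drop0.
under eq_bigr => i _ do rewrite /= -/(del i w).
case: b; case: a => /=; rewrite ?IHw; try by rewrite big1 // addbF.
- by case: (path _ true w); case: (path _ false w).
- by case: (path _ true w); case: (path _ false w).
Qed.

(** A label of absolute value [a] is encoded as [a.*2] when negative and as
    [a.*2.+1] when positive; [flip] changes the sign. *)
Definition flip (l : nat) := if odd l then l.-1 else l.+1.

Lemma odd_flip l : odd (flip l) = ~~ odd l.
Proof. by rewrite /flip; case: l => [|l] //=; case o: (odd l); rewrite /= ?o. Qed.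

Lemma half_flip l : (flip l)./2 = l./2.
Proof.
rewrite -[in LHS](odd_double_half l) /flip oddD odd_double addbF oddb.
by case: (odd l) => /=; rewrite ?add1n ?add0n ?doubleK //= uphalf_double.
Qed.

Lemma half_odd_inj a b : a./2 = b./2 -> odd a = odd b -> a = b.
Proof. by move=> h o; rewrite -(odd_double_half a) h o odd_double_half. Qed.

Lemma half_eq_flip a b : a./2 = b./2 -> b != flip a -> a = b.
Proof.
move=> h ne; apply: half_odd_inj => //; apply: contraNeq ne => o.
apply/eqP/half_odd_inj; rewrite ?half_flip // odd_flip.
by case: (odd a) (odd b) o => [] [].
Qed.

(** The first sign, in increasing order of absolute values, must be positive:
    the path starts from the negative sign [false]. *)
Definition alternating_labels (L : seq nat) : bool :=
  path neqb false (map odd (sort leq L)).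

Lemma perm_alternating_labels L K :
  perm_eq L K -> alternating_labels L = alternating_labels K.
Proof.
by move=> /(perm_sortP leq_total leq_trans anti_leq) e; rewrite /alternating_labels e.
Qed.

(** With this condition two labels of equal absolute value are equal, so that
    sorting the labels by code sorts them by absolute value and differing signs
    force differing absolute values. *)
Definition flip_free (L : seq nat) := {in L &, forall x y, y != flip x}.

(** This is the local step of Fan's count: a simplex has an odd number of
    facets that alternate starting with [+] exactly when it alternates itself,
    with either first sign. *)
Lemma sum_rem_alternating (L : seq nat) : flip_free L ->
  \big[addb/false]_(x <- L) alternating_labels (rem x L)
    = alternating_labels L (+) alternating_labels (map flip L).
Proof.
move=> ffL; set K := sort leq L.
have KL : perm_eq K L by rewrite perm_sort.
have sK : sorted leq K by apply: sort_sorted leq_total _.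
rewrite -(perm_big _ KL) /=.
have -> : \big[addb/false]_(x <- K) alternating_labels (rem x L) =
    \big[addb/false]_(x <- K) alternating_labels (rem x K).
  apply: eq_bigr => x _; apply: perm_alternating_labels.
  by rewrite perm_sym; apply: perm_rem.
rewrite (big_nth 0) big_mkord.
have -> : \big[addb/false]_(i < size K) alternating_labels (rem (nth 0 K i) K)
   = \big[addb/false]_(i < size (map odd K)) path neqb false (del i (map odd K)).
  rewrite size_map; apply: eq_bigr => i _.
  rewrite (perm_alternating_labels (perm_rem_nth 0 (ltn_ord i))).
  rewrite /alternating_labels sorted_sort ?map_del //; first exact: leq_trans.
  exact: (subseq_sorted leq_trans (del_subseq _ _)).
rewrite sum_del_path; congr (_ (+) _).
rewrite -(perm_alternating_labels (perm_map flip KL)) /alternating_labels.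
rewrite sorted_sort; last 2 first.
- exact: leq_trans.
- have: {in K &, forall x y, y != flip x}.
    by move=> x y; rewrite !(perm_mem KL); apply: ffL.
  rewrite sorted_map; move=> ffK; apply: sub_in_sorted sK; last first.
    by apply/allP=> x xK; apply: (xK).
  move=> x y xK yK /= xy; have := ffK x y xK yK; have := half_leq xy.
  rewrite leq_eqVlt => /orP[/eqP h|h] ne.
    by rewrite (half_eq_flip h ne).
  by move: h; rewrite -(half_flip x) -(half_flip y); apply: contraLR;
    rewrite -!ltnNge ltnS => /ltnW/half_leq.
have -> : map odd (map flip K) = map negb (map odd K).
  by rewrite -!map_comp; apply: eq_map => x /=; rewrite odd_flip.
by elim: (map odd K) {1 2}false => //= a w IHw b; rewrite -IHw; case: a b => [] [].
Qed.

Lemma alternating_labels_size (L : seq nat) k :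
  flip_free L -> all (fun l => l < k.*2) L -> alternating_labels L -> size L <= k.
Proof.
move=> ffL /allP Lk; rewrite /alternating_labels; set K := sort leq L => altK.
have KL : perm_eq K L by rewrite perm_sort.
have sK : sorted leq K by apply: sort_sorted leq_total _.
have {}altK : sorted (fun a b => odd a != odd b) K.
  by case: (K) altK => //= a l /andP[_]; rewrite path_map.
have sK2 : sorted (fun a b => a./2 < b./2) K.
  have ffK : {in K &, forall x y, y != flip x}.
    by move=> x y; rewrite !(perm_mem KL); apply: ffL.
  elim: (K) sK altK ffK => // a [//|b l] IHl /= /andP[ab sK] /andP[oab aK] ffK.
  apply/andP; split; last first.
    by apply: (IHl sK aK) => x y xl yl; apply: ffK; rewrite inE ?xl ?yl orbT.
  have := half_leq ab; rewrite leq_eqVlt => /orP[/eqP h|//].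
  case/eqP: oab; congr odd; apply: half_eq_flip h _.
  by apply: ffK; rewrite !inE eqxx ?orbT.
rewrite -(perm_size KL) -(size_map half) -(size_iota 0 k); apply: uniq_leq_size.
  by apply: (sorted_uniq ltn_trans ltnn); rewrite sorted_map.
move=> _ /mapP[l lK ->]; rewrite mem_iota add0n /=.
by rewrite -ltn_double (leq_ltn_trans _ (Lk l _)) -?(perm_mem KL)
  // -[leqRHS]odd_double_half leq_addl.
Qed.

Definition opp_signs (N : nat) (X : N.-tuple sign) : N.-tuple sign :=
  map_tuple (omap negb) X.

Definition sub_signs (N : nat) (X Y : N.-tuple sign) : Prop :=
  forall j, tnth X j != None -> tnth Y j = tnth X j.

(** Sums modulo 2 cancel along a fixed-point-free involution; the predicate [p]
    tells the two elements of each orbit apart. *)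
Lemma addb_sum_pair (T : finType) (A : pred T) (E : T -> bool) (p : pred T)
    (g : T -> T) :
  involutive g -> (forall x, A x -> [/\ A (g x), E (g x) = E x & p (g x) = ~~ p x]) ->
  \big[addb/false]_(x | A x) E x = false.
Proof.
move=> gK gA; have Ag x : A (g x) = A x.
  by apply/idP/idP => /gA[] //; rewrite gK.
rewrite (bigID p) /= [X in _ (+) X](reindex_inj (inv_inj gK)) /=.
rewrite [X in _ (+) X](eq_big (fun x => A x && p x) E) ?addbb //.
  by move=> x; rewrite Ag; case Ax: (A x) => //=; have [_ _ ->] := gA x Ax; rewrite negbK.
by move=> x /andP[]; rewrite Ag => Ax _; have [_ ->] := gA x Ax.
Qed.

(** * The octahedral Tucker lemma *)

Section Tucker.
Variables (N : nat) (lam : N.-tuple sign -> nat).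

(** A maximal chain [X_1 < ... < X_N] of nonzero sign vectors is given by the
    rank at which each coordinate enters the support and by the sign that the
    coordinate receives. *)
Definition flag := ('S_N * {ffun 'I_N -> bool})%type.

Definition flag_signs (f : flag) (i : nat) : N.-tuple sign :=
  [tuple if f.1 j < i then Some (f.2 j) else None | j < N].

(** The coordinates from [d] on are in normal position, so that these flags are
    the maximal chains of the cross-polytope on the first [d] coordinates.  With
    this encoding the flags of level [d] are literally the flags of level
    [d.+1] whose last coordinate to enter is [d], with a positive sign. *)
Definition small_flag (d : nat) (f : flag) : bool :=
  [forall j : 'I_N, (d <= j) ==> (f.1 j == j) && f.2 j].

Definition flag_labels (f : flag) (J : seq nat) := [seq lam (flag_signs f i) | i <- J].

Definition flag_parity (d : nat) : bool :=
  \big[addb/false]_(f : flag | small_flag d f)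
    alternating_labels (flag_labels f (iota 1 d)).

Hypothesis lam_opp : forall X : N.-tuple sign, has isSome X
  -> lam (opp_signs X) = flip (lam X).
Hypothesis lam_sub : forall X Y : N.-tuple sign, has isSome X -> sub_signs X Y
  -> lam Y != flip (lam X).

Lemma flag_signs_neq0 f i : 0 < i -> i <= N -> has isSome (flag_signs f i).
Proof.
move=> i0 iN; have N0 := leq_trans i0 iN.
apply/(has_nthP None); pose j := (f.1^-1)%g (Ordinal N0); exists j.
  by rewrite size_tuple.
by rewrite -tnth_nth tnth_mktuple permKV /= i0.
Qed.

Lemma flag_signs_sub f i j : i <= j -> sub_signs (flag_signs f i) (flag_signs f j).
Proof.
by move=> ij k; rewrite !tnth_mktuple; case: ltnP => // /leq_trans ->.
Qed.

Lemma flag_labels_flip_free f d : d <= N -> flip_free (flag_labels f (iota 1 d)).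
Proof.
move=> dN _ _ /mapP[i + ->] /mapP[j + ->].
rewrite !mem_iota add1n !ltnS => /andP[i0 id] /andP[j0 jd].
have iN := leq_trans id dN; have jN := leq_trans jd dN.
have [ij|/ltnW ji] := leqP i j.
  by apply: lam_sub; [apply: flag_signs_neq0 | apply: flag_signs_sub].
have := lam_sub (flag_signs_neq0 f j0 jN) (flag_signs_sub (f:=f) ji).
apply: contra => /eqP ->; apply/eqP/half_odd_inj; first by rewrite !half_flip.
by rewrite !odd_flip negbK.
Qed.

Lemma sum_rem_flag_labels f (J : seq nat) :
  \big[addb/false]_(x <- flag_labels f J) alternating_labels (rem x (flag_labels f J))
  = \big[addb/false]_(i <- J) alternating_labels (flag_labels f (rem i J)).
Proof.
rewrite /flag_labels big_map big_seq [RHS]big_seq; apply: eq_bigr => i iJ.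
apply: perm_alternating_labels; set g := fun i => _.
rewrite -(perm_cons (g i)) -map_cons.
apply: (perm_trans (y := map g J)); last by apply: perm_map; apply: perm_to_rem.
by rewrite perm_sym; apply: perm_to_rem; apply: map_f.
Qed.

Lemma flag_parity0 : flag_parity 0 = true.
Proof.
rewrite /flag_parity (big_pred1 (1%g, [ffun=> true])) // => -[p s].
apply/forallP/eqP => [h|[-> ->] j]; last by rewrite perm1 ffunE eqxx.
congr (_, _); first by apply/permP => j; have /andP[/eqP-> _] := h j; rewrite perm1.
by apply/ffunP => j; have /andP[_ ->] := h j; rewrite ffunE.
Qed.

(** The sphere of level [d.+1] consists of two opposite hemispheres, and the
    antipodal map exchanges the two kinds of alternating chains; hence its
    parity is that of all alternating chains of the upper hemisphere, that is of
    the pairs of such a chain and an alternating facet starting with [+].  A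
    facet inside the hemisphere lies in two chains: exchange two consecutive
    ranks, or change the sign of the coordinate of last rank.  The facets left
    unpaired are those on the equator, which is the sphere of level [d]. *)
Lemma flag_parityS d : d < N -> flag_parity d.+1 = flag_parity d.
Proof.
move=> dN; pose jd := Ordinal dN.
pose upper (f : flag) := small_flag d.+1 f && f.2 jd.
pose E J f := alternating_labels (flag_labels f J).
pose opp_flag (f : flag) : flag := (f.1, [ffun k => f.2 k (+) (k <= d)]).
have oppK : involutive opp_flag.
  move=> [p s]; congr (_, _); apply/ffunP => k; rewrite !ffunE /=.
  by rewrite -addbA addbb addbF.
have opp_small f : small_flag d.+1 (opp_flag f) = small_flag d.+1 f.
  apply: eq_forallb => j; rewrite /= ffunE leqNgt ltnS.
  by case: (j <= d); rewrite ?addbF.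
have opp_labels f : small_flag d.+1 f -> E (iota 1 d.+1) (opp_flag f) =
    alternating_labels (map flip (flag_labels f (iota 1 d.+1))).
  move=> /forallP fd; congr alternating_labels; rewrite /flag_labels -map_comp.
  apply/eq_in_map => i; rewrite mem_iota add1n ltnS => /andP[i0 id] /=.
  rewrite -lam_opp; last by rewrite flag_signs_neq0 // (leq_trans id dN).
  congr lam; apply/eq_from_tnth => k; rewrite [RHS]tnth_map !tnth_mktuple /= ffunE.
  case: ltnP => //= ki; rewrite [k <= d]leqNgt; case: ltnP => [dk|]; last
    by rewrite addbT.
  by have /andP[/eqP fk _] := implyP (fd k) dk; move: ki;
    rewrite fk ltnNge (leq_trans id).
(* Facets that omit an inner vector of the chain. *)
have swap_cancel i : i \in iota 1 d ->
    \big[addb/false]_(f | upper f) E (rem i (iota 1 d.+1)) f = false.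
  rewrite mem_iota add1n ltnS => /andP[i0 id].
  have iN : i < N := leq_ltn_trans id dN.
  pose b := Ordinal iN; pose a := Ordinal (leq_ltn_trans (leq_pred i) iN).
  have ab : a != b by rewrite -val_eqE /= neq_ltn ltn_predL i0.
  pose swap (f : flag) : flag := ((f.1 * tperm a b)%g, f.2).
  apply: (@addb_sum_pair _ upper _ (fun f : flag => (f.1^-1)%g a < (f.1^-1)%g b) swap).
    by move=> [p s]; rewrite /swap /= -mulgA tperm2 mulg1.
  move=> f /andP[/forallP fd fj]; split.
  - apply/andP; split=> //; apply/forallP => j; apply/implyP => dj.
    have /andP[/eqP fk ->] := implyP (fd j) dj; rewrite andbT /= permM fk tpermD //.
      by rewrite -val_eqE /= neq_ltn (leq_ltn_trans (leq_pred i)) // (leq_ltn_trans id).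
    by rewrite -val_eqE /= neq_ltn (leq_ltn_trans id).
  - congr alternating_labels; apply/eq_in_map => j.
    rewrite mem_rem_uniq ?iota_uniq // inE => /andP[ji _].
    congr lam; apply/eq_from_tnth => k; rewrite !tnth_mktuple /= permM.
    suff -> : (tperm a b (f.1 k) < j) = (f.1 k < j) by [].
    have [->|->|//] := tpermP; rewrite /= prednK //.
      by rewrite [i <= j]leq_eqVlt eq_sym (negPf ji).
    by rewrite [i <= j]leq_eqVlt eq_sym (negPf ji).
  - rewrite /= invMg tpermV !permM tpermL tpermR -leqNgt ltn_neqAle.
    by rewrite (inj_eq val_inj) (inj_eq perm_inj) eq_sym ab.
(* Facets that omit the largest vector and do not lie on the equator. *)
have top_cancel : \big[addb/false]_(f | upper f && (f.1 jd != jd)) E (iota 1 d) f = false.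
  pose turn (f : flag) : flag := (f.1, [ffun k => f.2 k (+) (f.1 k == jd)]).
  apply: (@addb_sum_pair _ (fun f : flag => upper f && (f.1 jd != jd)) _
    (fun f : flag => f.2 ((f.1^-1)%g jd)) turn).
    move=> [p s]; congr (_, _); apply/ffunP => k; rewrite !ffunE /=.
    by rewrite -addbA addbb addbF.
  move=> f /andP[/andP[/forallP fd fj] jf]; split.
  - rewrite jf andbT; apply/andP; split; last by rewrite /= ffunE (negPf jf) addbF.
    apply/forallP => j; apply/implyP => dj; have /andP[fk sk] := implyP (fd j) dj.
    by rewrite /= fk ffunE sk (eqP fk) -val_eqE /= gtn_eqF.
  - congr alternating_labels; apply/eq_in_map => j.
    rewrite mem_iota add1n ltnS => /andP[_ jle].
    congr lam; apply/eq_from_tnth => k; rewrite !tnth_mktuple /=.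
    case: ltnP => // kj; rewrite ffunE -val_eqE /= ltn_eqF ?addbF //.
    exact: leq_trans jle.
  - by rewrite /= ffunE permKV eqxx addbT.
rewrite [LHS](bigID (fun f : flag => f.2 jd)) /=.
rewrite [X in _ (+) X](reindex_inj (inv_inj oppK)) /=.
rewrite [X in _ (+) X](eq_big upper
  (fun f => alternating_labels (map flip (flag_labels f (iota 1 d.+1))))); last 2 first.
- by move=> f; rewrite opp_small /= ffunE leqnn addbT negbK.
- by move=> f /andP[]; rewrite opp_small => /opp_labels.
transitivity (\big[addb/false]_(f | upper f)
    \big[addb/false]_(i <- iota 1 d.+1) E (rem i (iota 1 d.+1)) f).
  rewrite -big_split; apply: eq_bigr => f _.
  rewrite -sum_rem_flag_labels sum_rem_alternating //.
  exact: flag_labels_flip_free.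
rewrite exchange_big.
have iotaE : iota 1 d.+1 = rcons (iota 1 d) d.+1.
  by rewrite -[d.+1]addn1 iotaD add1n addn1 cats1.
rewrite [in LHS]iotaE big_rcons -iotaE big_seq big1 ?addbF => [|i /swap_cancel//].
have -> : rem d.+1 (iota 1 d.+1) = iota 1 d.
  rewrite rem_filter ?iota_uniq // iotaE filter_rcons /= eqxx /=.
  by apply/all_filterP/allP => i; rewrite mem_iota add1n => /andP[_] /ltn_eqF /= ->.
rewrite (bigID (fun f : flag => f.1 jd != jd)) top_cancel /=.
rewrite /flag_parity; apply: eq_bigl => f; rewrite /upper negbK -andbA.
apply/andP/forallP => [[/forallP fd /andP[sj fj]] j|fd].
  apply/implyP; rewrite leq_eqVlt => /predU1P[dj|]; last exact: implyP (fd j).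
  by rewrite (_ : j = jd) ?sj ?fj //; apply: val_inj.
have /andP[fj sj] := implyP (fd jd) (leqnn d).
by rewrite fj sj; split=> //; apply/forallP => j; apply/implyP => /ltnW; apply/implyP.
Qed.

End Tucker.

(** Some maximal chain has alternating labels, because the number of these is
    odd; its [N] labels have distinct absolute values below [k]. *)
Theorem octahedral_tucker (N k : nat) (lam : N.-tuple sign -> nat) :
  (forall X : N.-tuple sign, has isSome X -> lam X < k.*2) ->
  (forall X : N.-tuple sign, has isSome X -> lam (opp_signs X) = flip (lam X)) ->
  (forall X Y : N.-tuple sign, has isSome X -> sub_signs X Y -> lam Y != flip (lam X)) ->
  N <= k.
Proof.
move=> lam_lt lam_opp lam_sub.
have parity d : d <= N -> flag_parity lam d.
  by elim: d => [|d IHd] dN; rewrite ?flag_parity0 // flag_parityS // IHd // ltnW.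
have [f altf|noalt] := pickP (fun f => alternating_labels (flag_labels lam f (iota 1 N))).
  rewrite -(size_iota 1 N) -(size_map (fun i => lam (flag_signs f i))).
  apply: alternating_labels_size altf; first exact: flag_labels_flip_free.
  apply/allP => _ /mapP[i + ->]; rewrite mem_iota add1n ltnS => /andP[i0 iN].
  by apply/lam_lt/flag_signs_neq0.
by have := parity N (leqnn N); rewrite /flag_parity big1 // => f _; apply: noalt.
Qed.

(** * Alternation and sign vectors *)

Lemma alt_geq (N : nat) (X : N.-tuple sign) w :
  alternating w -> subseq w X -> size w <= alt X.
Proof.
move=> altw /subseqP[b sb wE]; rewrite {}wE in altw *.
have sbN : size b == N by rewrite sb size_tuple.
exact: (leq_bigmax_cond (Tuple sbN) (F := fun b : N.-tuple bool => size (mask b X))).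
Qed.

Lemma alt_witness (N : nat) (X : N.-tuple sign) :
  exists w, [/\ alternating w, subseq w X & size w = alt X].
Proof.
pose P := [pred b : N.-tuple bool | alternating (mask b X)].
have P0 : 0 < #|P|.
  apply/card_gt0P; exists [tuple of nseq N false]; rewrite inE.
  by rewrite mask_false.
have [b Pb e] := eq_bigmax_cond (fun b : N.-tuple bool => size (mask b X)) P0.
by exists (mask b X); split; [| apply: mask_subseq | rewrite -e].
Qed.

(** Subsequences of [X] that alternate live inside its nonzero terms, which turns
    the order of sign vectors into the subsequence order. *)
Definition nonzero_signs (s : seq sign) := filter isSome s.

Definition first_sign (s : seq sign) : sign := head None (nonzero_signs s).

Lemma alternating_subseq_nonzero (w s : seq sign) :
  alternating w -> subseq w s = subseq w (nonzero_signs s).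
Proof. by move=> /andP[allw _]; rewrite subseq_filter allw. Qed.

Lemma subseq_nonzero_signs (N : nat) (X Y : N.-tuple sign) :
  sub_signs X Y -> subseq (nonzero_signs X) (nonzero_signs Y).
Proof.
move=> XY; have {XY} : forall i, nth None X i != None -> nth None Y i = nth None X i.
  move=> i; have [iN|Ni] := ltnP i N; last by rewrite nth_default ?size_tuple.
  by have := XY (Ordinal iN); rewrite !(tnth_nth None).
have : size X = size Y by rewrite !size_tuple.
elim: (tval X) (tval Y) => [|x s IHs] [|y t] // [st] h.
have {}IHs : subseq (nonzero_signs s) (nonzero_signs t).
  by apply: IHs => // i; apply: (h i.+1).
rewrite /nonzero_signs /= -!/(nonzero_signs _); case: x h => [a|] /= h.
  by have /= -> := h 0 isT; rewrite /= eqxx.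
by case: y h => [b|] _ //; apply: subseq_trans IHs (subseq_cons _ _).
Qed.

Lemma alternating_cons a b w :
  alternating (Some a :: Some b :: w) = (a != b) && alternating (Some b :: w).
Proof. by rewrite /alternating /= andbCA. Qed.

Lemma subseq_cons_neq (T : eqType) (x y : T) s t :
  x != y -> subseq (x :: s) (y :: t) -> subseq (x :: s) t.
Proof. by move=> /negPf /= ->. Qed.

(** The earliest nonzero term of [Y] precedes the one of [X] and differs from it.
    An optimal alternating subsequence of [X] may be taken to start with the
    first sign of [X], and the first term of [Y] can then be put in front. *)
Lemma alt_sub_lt (N : nat) (X Y : N.-tuple sign) : sub_signs X Y ->
  has isSome X -> first_sign X != first_sign Y -> alt X < alt Y.
Proof.
move=> /subseq_nonzero_signs XY X0.
have [w [altw wX <-]] := alt_witness X.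
have {}wX : subseq w (nonzero_signs X) by rewrite -alternating_subseq_nonzero.
have leY v : alternating v -> subseq v (nonzero_signs Y) -> size v <= alt Y.
  by move=> altv vY; apply: alt_geq => //; rewrite alternating_subseq_nonzero.
have allX : all isSome (nonzero_signs X) by apply: filter_all.
have allY : all isSome (nonzero_signs Y) by apply: filter_all.
have : nonzero_signs X != [::] by rewrite -has_filter.
rewrite /first_sign.
case: (nonzero_signs X) wX allX XY => // -[a|//] s wX _ XY _ /=.
case: (nonzero_signs Y) XY leY allY => // -[b|//] t XY leY _ /= ab.
have {}XY : subseq (Some a :: s) t by apply: subseq_cons_neq XY.
have {}ab : b != a by rewrite eq_sym; apply: contraNneq ab => ->.
case: w altw wX => [|[c|//] w] altw wX; first by apply: (leY [:: Some b]) => //=;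
  rewrite eqxx sub0seq.
have [ca|ca] := eqVneq c a.
  apply: (leY [:: Some b, Some c & w]); first by rewrite alternating_cons altw ca ab.
  by rewrite /= eqxx; apply: subseq_trans XY.
apply: ltnW; apply: (leY [:: Some b, Some a, Some c & w]).
  by rewrite !alternating_cons altw ab eq_sym ca.
have {}wX : subseq (Some c :: w) s by apply: subseq_cons_neq wX;
  apply: contraNneq ca => -[->].
by rewrite /= eqxx; apply: subseq_trans XY; rewrite /= eqxx.
Qed.

Lemma sub_signs_neq0 (N : nat) (X Y : N.-tuple sign) :
  sub_signs X Y -> has isSome X -> has isSome Y.
Proof.
move=> XY /hasP[_ /tnthP[j ->] Xj]; apply/hasP; exists (tnth Y j); first exact: mem_tnth.
by rewrite XY //; case: (tnth X j) Xj.
Qed.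

Lemma alt_gt0 (N : nat) (X : N.-tuple sign) : has isSome X -> 0 < alt X.
Proof.
move=> /hasP[[a|//] aX _]; apply: (alt_geq (w := [:: Some a])) => //.
by rewrite sub1seq.
Qed.

Lemma opp_signsK N : involutive (@opp_signs N).
Proof.
move=> X; apply/eq_from_tnth => j; rewrite !tnth_map.
by case: (tnth X j) => //= a; rewrite negbK.
Qed.

Lemma nonzero_signs_opp N (X : N.-tuple sign) :
  nonzero_signs (opp_signs X) = map (omap negb) (nonzero_signs X).
Proof. by rewrite /nonzero_signs filter_map; congr map; apply: eq_filter => -[]. Qed.

Lemma alternating_opp w : alternating w -> alternating (map (omap negb) w).
Proof.
case: w => [|[a|//] w] //; elim: w a => [|[b|] w IHw] a; [by [] | | by []].
rewrite !alternating_cons => /andP[ab altw]; apply/andP; split; last exact: IHw altw.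
by case: a b ab {altw} => [] [].
Qed.

Lemma alt_opp N (X : N.-tuple sign) : alt (opp_signs X) = alt X.
Proof.
have leX (Y : N.-tuple sign) : alt Y <= alt (opp_signs Y).
  have [w [altw wY <-]] := alt_witness Y; rewrite -(size_map (omap negb)).
  by apply: alt_geq; [apply: alternating_opp | apply: map_subseq].
by apply/eqP; rewrite eqn_leq leX -{2}(opp_signsK X) leX.
Qed.

Lemma first_sign_opp N (X : N.-tuple sign) :
  first_sign (opp_signs X) = omap negb (first_sign X).
Proof. by rewrite /first_sign nonzero_signs_opp; case: (nonzero_signs X). Qed.

Lemma first_sign_neq0 s : has isSome s -> first_sign s != None.
Proof.
rewrite has_filter /first_sign -/(nonzero_signs s) => s0.
by have := filter_all isSome s; rewrite -/(nonzero_signs s);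
  case: (nonzero_signs s) s0 => // -[].
Qed.

(** * The altermatic lower bound on the chromatic number *)

Lemma mem_sign_class (T : finType) (sigma : #|T|.-tuple T) X a j : uniq sigma ->
  (tnth sigma j \in sign_class sigma X a) = (tnth X j == a).
Proof.
move=> us; rewrite mem_imset ?inE //.
exact/tuple_uniqP.
Qed.

Lemma sign_class_opp (T : finType) (sigma : #|T|.-tuple T) X a :
  sign_class sigma (opp_signs X) (Some a) = sign_class sigma X (Some (~~ a)).
Proof.
have e j : (tnth (opp_signs X) j == Some a) = (tnth X j == Some (~~ a)).
  by rewrite tnth_map; case: (tnth X j) a => [[]|] [].
by apply/setP => x; apply/imsetP/imsetP => -[j]; rewrite inE => Xj ->;
  exists j => //; rewrite inE ?e // -e.
Qed.

Lemma sign_class_sub (T : finType) (sigma : #|T|.-tuple T) X Y a :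
  sub_signs X Y -> sign_class sigma X (Some a) \subset sign_class sigma Y (Some a).
Proof.
move=> XY; apply/imsetS/subsetP => j; rewrite !inE => /eqP Xj.
by rewrite XY Xj.
Qed.

Lemma sign_class_disjoint (T : finType) (sigma : #|T|.-tuple T) X a : uniq sigma ->
  [disjoint sign_class sigma X (Some a) & sign_class sigma X (Some (~~ a))].
Proof.
move=> us; apply/pred0P => x /=; apply/negP => /andP[/imsetP[j + ->]].
by rewrite mem_sign_class // inE => /eqP ->; case: a.
Qed.

(** Label a sign vector that contains no hyperedge by its alternation number and
    its first sign, and any other one by [alt_ord sigma] plus the largest colour
    of a hyperedge in one of its two sign classes, with the sign of that class.
    Two complementary labels on comparable vectors would give either a gain in
    alternation number or two disjoint hyperedges of the same colour, so Tucker's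
    lemma bounds the number of vertices by the number of absolute values. *)
Section ChromaticBound.
Variables (H : hypergraph) (C : nat) (col : KG H -> 'I_C).
Hypothesis col_proper : forall x y, adj x y -> col x != col y.
Variable sigma : #|H|.-tuple H.
Hypothesis uniq_sigma : uniq sigma.

(** Colours are shifted by one: the value [0] means that [A] contains no
    hyperedge. *)
Definition top_colour (A : {set H}) : nat := \max_(e : KG H | val e \subset A) (col e).+1.

Lemma top_colourS (A B : {set H}) : A \subset B -> top_colour A <= top_colour B.
Proof.
move=> AB; apply/bigmax_leqP => e eA; apply: leq_bigmax_cond.
exact: subset_trans AB.
Qed.

Lemma top_colour_le A : top_colour A <= C.
Proof. by apply/bigmax_leqP => e _; apply: ltn_ord. Qed.

Lemma top_colour_witness A : 0 < top_colour A ->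
  exists2 e : KG H, val e \subset A & (col e).+1 = top_colour A.
Proof.
move=> A0; have P0 : 0 < #|[pred e : KG H | val e \subset A]|.
  rewrite lt0n; apply: contraTneq A0 => /eqP/pred0P e0.
  by rewrite /top_colour big_pred0.
have [e eA ce] := eq_bigmax_cond (fun e : KG H => (col e).+1) P0.
by exists e; rewrite // -ce.
Qed.

Lemma top_colour_eq0 A : (top_colour A == 0) = ~~ contains_hyperedge A.
Proof.
apply/eqP/existsPn => [A0 e|noe]; last first.
  by apply: big_pred0 => e; have := noe (val e); rewrite (valP e) => /negPf.
apply/negP => /andP[eH eA].
have : (col (Sub e eH)).+1 <= top_colour A by apply: leq_bigmax_cond.
by rewrite A0.
Qed.

Lemma top_colour_neq (A B : {set H}) : [disjoint A & B] -> 0 < top_colour A ->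
  top_colour A != top_colour B.
Proof.
move=> AB A0; apply/eqP => eAB.
have [e eA ce] := top_colour_witness A0.
have [f fB cf] : exists2 f : KG H, val f \subset B & (col f).+1 = top_colour B.
  by apply: top_colour_witness; rewrite -eAB.
have ef : [disjoint val e & val f].
  by apply: disjointWl eA (disjointWr fB AB).
have : adj e f.
  rewrite /= /kneser_adj ef andbT; apply/eqP => eqef.
  have := hyperedges_nonempty H; have := valP f.
  by move: ef; rewrite eqef -setI_eq0 setIid => /eqP ->  /= ->.
move=> /col_proper/eqP; apply; apply/val_inj/eqP.
by rewrite -eqSS ce cf eAB.
Qed.

Let plus X := top_colour (sign_class sigma X (Some true)).
Let minus X := top_colour (sign_class sigma X (Some false)).

Definition sign_label (X : #|H|.-tuple sign) : nat :=
  if maxn (plus X) (minus X) is c.+1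
  then (minus X < plus X) + (alt_ord sigma + c).*2
  else (first_sign X == Some true) + (alt X).-1.*2.

Lemma chromatic_bound : #|H| <= alt_ord sigma + C.
Proof.
have plus_opp X : plus (opp_signs X) = minus X by rewrite /plus sign_class_opp.
have minus_opp X : minus (opp_signs X) = plus X by rewrite /minus sign_class_opp.
have neq X : maxn (plus X) (minus X) != 0 -> plus X != minus X.
  have [p0|p0 _] := posnP (plus X); first by rewrite p0 max0n eq_sym.
  by apply: top_colour_neq => //; apply: sign_class_disjoint.
have alt_le X : maxn (plus X) (minus X) = 0 -> alt X <= alt_ord sigma.
  move=> /eqP; rewrite -leqn0 geq_max !leqn0 !top_colour_eq0 => XH.
  exact: (leq_bigmax_cond (F := @alt _)).
have halfE (b : bool) a : (b + a.*2)./2 = a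
  by rewrite halfD odd_double andbF add0n doubleK; case: b.
have oddE (b : bool) a : odd (b + a.*2) = b by rewrite oddD odd_double addbF oddb.
apply: (octahedral_tucker (lam := sign_label)).
- move=> X X0; have -> l k : (l < k.*2) = (l./2 < k) by rewrite ltn_half_double.
  rewrite /sign_label; case e: maxn => [|c]; rewrite halfE.
    by rewrite prednK ?alt_gt0 // (leq_trans (alt_le X e)) ?leq_addr.
  by rewrite ltn_add2l -e geq_max !top_colour_le.
- move=> X X0; apply: half_odd_inj; rewrite ?half_flip ?odd_flip /sign_label;
  rewrite plus_opp minus_opp maxnC; case e: maxn => [|c];
    rewrite ?halfE ?oddE ?alt_opp //.
    by rewrite first_sign_opp; case: (first_sign X) (first_sign_neq0 X0) => // -[].
  by have := neq X; rewrite e -leqNgt ltn_neqAle => -> //.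
- move=> X Y X0 XY; apply/eqP => e.
  have := congr1 odd e; have := congr1 half e; rewrite half_flip odd_flip /sign_label.
  have pXY : plus X <= plus Y by apply/top_colourS/sign_class_sub.
  have mXY : minus X <= minus Y by apply/top_colourS/sign_class_sub.
  have aY X' c' : maxn (plus X') (minus X') = 0 -> has isSome X'
    -> (alt X').-1 = alt_ord sigma + c' -> False.
    move=> /alt_le aX X'0 ea; have := alt_gt0 X'0; move: aX;
      rewrite -[alt X']prednK ?alt_gt0 //.
    by rewrite ea ltnNge leq_addr.
  have noX : maxn (plus X) (minus X) <= maxn (plus Y) (minus Y)
    by rewrite geq_max !leq_max pXY mXY orbT.
  case eX: maxn noX => [|c] noX; case eY: maxn noX => [|c'] // noX; rewrite !halfE !oddE.
  - have Y0 : has isSome Y := sub_signs_neq0 XY X0.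
    move=> ea of_; have [/eqP fXY|/(alt_sub_lt XY X0)]
      := boolP (first_sign X == first_sign Y).
      by move: of_; rewrite fXY; case: (_ == _).
    by have := alt_gt0 X0; have := alt_gt0 Y0; lia.
  - by move=> /esym /aY - /(_ eX X0).
  - by have := neq Y; rewrite eY => /(_ isT); lia.
Qed.
End ChromaticBound.

(** * Colourings and homomorphisms *)

Lemma colorable_map (G : sgraph) (K : finType) (f : G -> K) :
  (forall x y, adj x y -> f x != f y) -> colorable G #|K|.
Proof.
move=> fP; apply/existsP; exists [ffun x => enum_rank (f x)].
apply/forallP => x; apply/forallP => y; apply/implyP => /fP.
by rewrite !ffunE (inj_eq enum_rank_inj).
Qed.

Lemma colorable_hom (F G : sgraph) c : has_hom F G -> colorable G c -> colorable F c.
Proof.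
move=> [f fP] /existsP[g gP]; rewrite -(card_ord c).
apply: (@colorable_map _ _ (g \o f)) => x y /fP fxy.
by have /forallP/(_ (f y))/implyP/(_ fxy) := forallP gP (f x).
Qed.

Lemma altermatic_bound (H : hypergraph) (F : sgraph) c :
  has_hom (KG H) F -> colorable F c -> #|H| - alt_hyp H <= c.
Proof.
move=> HF /(colorable_hom HF)/existsP[g gP].
have gadj x y : adj x y -> g x != g y by apply/implyP; apply: (forallP (forallP gP x) y).
rewrite leq_subLR addnC /alt_hyp.
elim/big_ind: _ => [|a b ha hb|s us].
- exact: leq_addl.
- by rewrite addn_minr leq_min ha hb.
- by rewrite addnC; apply: (chromatic_bound gadj).
Qed.

Lemma alt_hyp_le (H : hypergraph) (sigma : #|H|.-tuple H) : uniq sigma ->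
  alt_hyp H <= alt_ord sigma.
Proof.
move=> us; rewrite /alt_hyp; have := mem_index_enum sigma.
elim: (index_enum _) => //= s l IHl; rewrite inE big_cons => /predU1P[<-|/IHl le_s].
  by rewrite us geq_minl.
by case: ifP => // _; rewrite geq_min le_s orbT.
Qed.

(** * Matchings of a complete bipartite graph as rook placements *)

Section Rooks.
Variables (m n r : nat).
Hypothesis r_gt0 : 0 < r.

Definition rook_set (A : {set 'I_m * 'I_n}) : bool :=
  [forall x in A, forall y in A, (x != y) ==> (x.1 != y.1) && (x.2 != y.2)].

Lemma rook_setP (A : {set 'I_m * 'I_n}) :
  reflect {in A &, forall x y, x != y -> (x.1 != y.1) && (x.2 != y.2)} (rook_set A).
Proof.
apply: (iffP forall_inP) => [h x y xA yA|h x xA].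
  by apply: implyP; apply: (forall_inP (h x xA)).
by apply/forall_inP => y yA; apply/implyP; apply: h.
Qed.

Definition rook_placements : {set {set 'I_m * 'I_n}} :=
  [set A | rook_set A & #|A| == r].

Lemma rook_placements_nonempty : set0 \notin rook_placements.
Proof. by rewrite inE cards0 eq_sym eqn0Ngt r_gt0 andbF. Qed.

Definition rook_hypergraph := Hypergraph rook_placements_nonempty.

Definition cell_edge (x : 'I_m * 'I_n) : {set complete_bipartite m n} :=
  [set inl x.1; inr x.2].

Lemma disjoint_cell_edge x y :
  [disjoint cell_edge x & cell_edge y] = (x.1 != y.1) && (x.2 != y.2).
Proof.
rewrite disjoints_subset subUset !sub1set !inE !negb_or.
by rewrite ![inl _ == inr _]/(_ == _) ![inr _ == inl _]/(_ == _) /= andbT.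
Qed.

Lemma cell_edge_inj : injective cell_edge.
Proof.
move=> x y e; have := disjoint_cell_edge x y; have := disjoint_cell_edge y y.
move: (disjoint_cell_edge x y). 
have /setP/(_ (inl y.1)) : cell_edge x = cell_edge y by [].
have /setP/(_ (inr y.2)) : cell_edge x = cell_edge y by [].
rewrite !inE !eqxx !orbT => /orP[/eqP//|/eqP[e2]] /orP[/eqP[e1]|/eqP//] _ _ _.
by case: x y e1 e2 {e} => [i j] [i' j'] /= <- <-.
Qed.

Lemma edges_cell_edge : edges (complete_bipartite m n) = cell_edge @: setT.
Proof.
apply/setP => e; rewrite inE; apply/existsP/imsetP => [[x /existsP[y]]|[[i j] _ ->]].
  case: x y => [i|j] [i'|j'] /andP[] //= _ /eqP ->.
    by exists (i, j').
  by exists (i', j); rewrite // /cell_edge setUC.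
by exists (inl i); apply/existsP; exists (inr j); rewrite eqxx.
Qed.

Lemma cell_edge_matching (A : {set 'I_m * 'I_n}) :
  (cell_edge @: A \in matchings (complete_bipartite m n) r) = (A \in rook_placements).
Proof.
rewrite !inE edges_cell_edge imsetS ?subsetT // (card_imset _ cell_edge_inj) /=.
congr (_ && _); apply/trivIsetP/rook_setP => h => [x y xA yA xy|].
  by rewrite -disjoint_cell_edge h ?imset_f // (inj_eq cell_edge_inj).
move=> _ _ /imsetP[x xA ->] /imsetP[y yA ->];
  rewrite (inj_eq cell_edge_inj) disjoint_cell_edge.
exact: h.
Qed.

Lemma cell_edgeK (M : {set {set complete_bipartite m n}}) :
  M \in matchings (complete_bipartite m n) r -> cell_edge @: (cell_edge @^-1: M) = M.
Proof.
rewrite inE edges_cell_edge => /and3P[/subsetP Me _ _]; apply/setP => e.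
apply/imsetP/idP => [[x]|eM]; first by rewrite inE => xM ->.
by have /imsetP[x _ ex] := Me e eM; exists x; rewrite // inE -ex.
Qed.

Lemma rook_hom_equiv :
  hom_equiv (KG rook_hypergraph) (matching_kneser (complete_bipartite m n) r).
Proof.
split.
  pose f (A : KG rook_hypergraph) : matching_kneser (complete_bipartite m n) r :=
    exist _ (cell_edge @: val A) (etrans (cell_edge_matching _) (valP A)).
  exists f => A B /andP[AB dAB]; apply/andP; split.
    by rewrite -val_eqE /= (inj_eq (imset_inj cell_edge_inj)).
  rewrite /=; rewrite -setI_eq0 -imsetI; last by move=> x y _ _; apply: cell_edge_inj.
  by rewrite imset_eq0 setI_eq0.
have gP (M : matching_kneser (complete_bipartite m n) r) :
    cell_edge @^-1: val M \in rook_placements.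
  by rewrite -cell_edge_matching cell_edgeK ?(valP M).
pose g (M : matching_kneser (complete_bipartite m n) r) : KG rook_hypergraph
  := exist _ (cell_edge @^-1: val M) (gP M).
exists g => M M' /andP[MM dMM]; apply/andP; split.
  apply: contraNneq MM => /(congr1 val) /= e; apply/eqP/val_inj.
  by rewrite -(cell_edgeK (valP M)) e cell_edgeK ?(valP M').
by rewrite /= -setI_eq0 -preimsetI (_ : val M :&: val M' = set0) ?preimset0 //;
  apply/eqP; rewrite setI_eq0.
Qed.

(** A placement of [r] rooks has a rook in a column of index at least [r.-1]; the
    colour is the cell of such a rook. *)
Lemma rook_colorable : r <= n -> colorable (KG rook_hypergraph) (m * (n - r + 1)).
Proof.
move=> rn.
have deepP (A : KG rook_hypergraph) : exists x, (x \in val A) && (r.-1 <= x.2).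
  apply/existsP; apply: contraT => /existsPn noA.
  have := valP A; rewrite inE => /andP[/rook_setP rA /eqP cA].
  have : #|[set x.2 | x in val A]| <= r.-1.
    rewrite -[leqRHS](size_iota 0) cardE -(size_map val); apply: uniq_leq_size.
      by rewrite map_inj_uniq ?enum_uniq //; apply: val_inj.
    move=> _ /mapP[j + ->]; rewrite mem_enum mem_iota add0n => /imsetP[x xA ->].
    by have := noA x; rewrite xA -ltnNge.
  rewrite card_in_imset ?cA ?prednK //; first by rewrite leqNgt prednK ?leqnn.
  by move=> x y xA yA exy; apply: contraTeq isT => /(rA x y xA yA);
    rewrite exy eqxx andbF.
pose shift (x : 'I_m * 'I_n) : 'I_m * 'I_(n - r).+1 := (x.1, inord (x.2 - r.-1)).
have shift_inj (x y : 'I_m * 'I_n) : r.-1 <= x.2 -> r.-1 <= y.2 -> shift x = shift y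
  -> x = y.
  move=> rx ry [e1 /(congr1 val)]; rewrite /= !inordK; try
    by case: x y {e1} rx ry => [? []] ? ? [? []] /=; lia.
  move=> e2; case: x y e1 e2 rx ry => [i j] [i' j'] /= -> e2 rx ry; congr (_, _).
  by apply: val_inj => /=; lia.
rewrite addn1 -[m in m * _]card_ord -[X in _ * X]card_ord -card_prod.
apply: (@colorable_map _ _ (fun A => shift (xchoose (deepP A)))) => A B /andP[_ dAB].
apply: contraTneq dAB => eAB.
have /andP[xA rx] := xchooseP (deepP A); have /andP[yB ry] := xchooseP (deepP B).
apply/negP => /disjoint_setI0/setP/(_ (xchoose (deepP A))).
by rewrite !inE xA (shift_inj _ _ rx ry eAB) yB.
Qed.
End Rooks.

(** * Konig's theorem *)

Section Konig.
Variables P Q : finType.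
Implicit Types (E M : {set P * Q}) (W : {set P + Q}).

Definition covers E W := forall x, x \in E -> (inl x.1 \in W) || (inr x.2 \in W).

Definition independent M :=
  {in M &, forall x y, x != y -> (x.1 != y.1) && (x.2 != y.2)}.

(** Induction on the number of edges, after de Caen.  If no edge can be deleted
    without lowering the covering number and two edges [e], [f] share a vertex
    [x], take covers [W1] of [E :\ e] and [W2] of [E :\ f] with less than [k]
    vertices.  Every edge meets their intersection or lies within [x] and their
    symmetric difference, which has at most [2 * (k - 1 - #|W1 :&: W2|) + 1]
    elements; the smaller of its two sides, added to the intersection, is a cover
    with less than [k] vertices. *)
Lemma konig E k : (forall W, covers E W -> k <= #|W|) ->
  exists M, [/\ M \subset E, independent M & k <= #|M|].
Proof.
have [N] := ubnP #|E|; elim: N E => // N IHN E EN kE.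
have [/exists_inP[e eE /forall_inP ek]|crit] :=
  boolP [exists e in E,
    forall (W : {set P + Q} | [forall x in E :\ e, (inl x.1 \in W) || (inr x.2 \in W)]),
    k <= #|W|].
  have [||M [ME indM kM]] := IHN (E :\ e).
  - by rewrite -ltnS (leq_trans _ EN) // ltnS [X in _ < X](cardsD1 e) eE.
  - by move=> W cW; apply: ek; apply/forall_inP.
  by exists M; split=> //; apply: subset_trans ME (subsetDl _ _).
have {}crit e : e \in E -> exists2 W, covers (E :\ e) W & #|W| < k.
  move=> eE; move/exists_inPn: crit => /(_ e eE) /forall_inPn[W cW].
  by rewrite -ltnNge => Wk; exists W => //; apply/forall_inP.
have [ind|] := boolP [forall x in E, forall y in E,
  (x != y) ==> (x.1 != y.1) && (x.2 != y.2)].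
  exists E; split=> //.
    by move=> x y xE yE; move/forall_inP/(_ x xE)/forall_inP/(_ y yE)/implyP: ind.
  apply: (leq_trans (kE [set inl x.1 | x in E] _)); last exact: leq_imset_card.
  by move=> x xE; rewrite imset_f.
move=> /forall_inPn[e eE /forall_inPn[f fE]];
  rewrite negb_imply negb_and !negbK => /andP[ef share].
pose ends (g : P * Q) : {set P + Q} := [set inl g.1; inr g.2].
have [x xe xf] : exists2 x, x \in ends e & x \in ends f.
  case/orP: share => /eqP s; [exists (inl e.1) | exists (inr e.2)];
  by rewrite !inE -?s eqxx ?orbT.
have coversE E' W : covers E' W <-> forall g, g \in E'
  -> exists2 v, v \in ends g & v \in W.
  split=> cW g gE; first by case/orP: (cW g gE) => vW;
    [exists (inl g.1) | exists (inr g.2)] => //; rewrite !inE eqxx ?orbT.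
  by have [v] := cW g gE; rewrite !inE => /orP[] /eqP -> -> //; rewrite orbT.
have miss g : g \in E
  -> exists W, [/\ covers (E :\ g) W, #|W| < k & [disjoint ends g & W]].
  move=> gE; have [W cW Wk] := crit g gE; exists W; split=> //.
  apply: contraLR Wk; rewrite -leqNgt => /pred0Pn[v /andP[vg vW]]; apply: kE.
  apply/coversE => h hE; have [->|hg] := eqVneq h g; first by exists v.
  by apply: (proj1 (coversE _ _) cW); rewrite !inE hg.
have [W1 [cW1 W1k dW1]] := miss e eE; have [W2 [cW2 W2k dW2]] := miss f fE.
pose V := x |: ((W1 :\: W2) :|: (W2 :\: W1)).
have xW1 : x \notin W1 by apply/negP => xW1; move/pred0P/(_ x): dW1; rewrite /= xe xW1.
have xW2 : x \notin W2 by apply/negP => xW2; move/pred0P/(_ x): dW2; rewrite /= xf xW2.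
have touch g : g \in E
  -> (exists2 v, v \in ends g & v \in W1 :&: W2) \/ (ends g \subset V).
  move=> gE.
  have [v1 v1g v1W] : exists2 v, v \in ends g & if g == e then v == x else v \in W1.
    have [->|ge] := eqVneq g e; first by exists x.
    by apply: (proj1 (coversE _ _) cW1); rewrite !inE ge.
  have [v2 v2g v2W] : exists2 v, v \in ends g & if g == f then v == x else v \in W2.
    have [->|gf] := eqVneq g f; first by exists x.
    by apply: (proj1 (coversE _ _) cW2); rewrite !inE gf.
  have [vW|] := boolP ((v1 \in W1 :&: W2) || (v2 \in W1 :&: W2)).
    by left; case/orP: vW => vW; [exists v1 | exists v2].
  rewrite negb_or !inE => /andP[v1N v2N]; right.
  have v1V : v1 \in V by rewrite !inE; case: eqP v1W v1N => [_ ->|_ ->] //;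
    case: (v1 \in W2); rewrite ?orbT.
  have v2V : v2 \in V by rewrite !inE; case: eqP v2W v2N => [_ ->|_ ->] //;
    case: (v2 \in W1); rewrite ?orbT.
  have v12 : v1 != v2.
    apply/eqP => v12; move: v1W v2W v1N; rewrite -v12.
    have [->|_] := eqVneq g e; first by rewrite (negPf ef) => /eqP -> xW;
      rewrite xW in xW2.
    by move=> vW; case: eqP => [_ /eqP vx|_ vW2];
      [rewrite -vx vW in xW1 | rewrite vW vW2].
  have -> : ends g = [set v1; v2].
    move: v1g v2g v12; rewrite !inE => /orP[] /eqP -> /orP[] /eqP ->;
      rewrite ?eqxx // => _.
    exact: setUC.
  by apply/subsetP => v /set2P[] ->.
pose L := [set v in V | is_inl v]; pose R := [set v in V | ~~ is_inl v].
have small (Z : {set P + Q}) : (forall g, g \in E -> ends g \subset V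
  -> exists2 v, v \in ends g & v \in Z) ->
    k <= #|Z| + #|W1 :&: W2|.
  move=> ZP; apply: (leq_trans _ (leq_card_setU Z (W1 :&: W2)).1); apply: kE;
    apply/coversE => g gE.
  have [[v vg vW]|gV] := touch g gE; first by exists v; rewrite // inE vW orbT.
  by have [v vg vZ] := ZP g gE gV; exists v; rewrite // inE vZ.
have kL : k <= #|L| + #|W1 :&: W2|.
  apply: small => g gE /subsetP gV; exists (inl g.1); rewrite !inE ?eqxx //.
  by have := gV (inl g.1); rewrite !inE eqxx /= andbT => ->.
have kR : k <= #|R| + #|W1 :&: W2|.
  apply: small => g gE /subsetP gV; exists (inr g.2); rewrite !inE ?eqxx //.
  by have := gV (inr g.2); rewrite !inE eqxx /= andbT => ->.
have VLR : #|L| + #|R| = #|V|.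
  rewrite -(cardsID [set v | is_inl v] V); congr (_ + _); apply: eq_card => v;
    rewrite !inE //.
  by rewrite andbC.
have cV : #|V| <= (#|W1 :\: W2| + #|W2 :\: W1|).+1.
  rewrite /V cardsU1 -add1n; apply: leq_add; first by case: (_ \notin _).
  exact: (leq_card_setU _ _).1.
have := cardsID W2 W1; have := cardsID W1 W2; rewrite [W2 :&: W1]setIC.
move: kL kR VLR cV W1k W2k; move: #|L| #|R| #|V| #|W1| #|W2| => l r' v a b.
move: #|W1 :&: W2| #|W1 :\: W2| #|W2 :\: W1| => c d d'; clear; lia.
Qed.
End Konig.

(** * Alternating sequences along a back and forth reading *)

Lemma subseq_unzip1_cat (T U : eqType) (w : seq (T * U)) (s t : seq T) :
  subseq (unzip1 w) (s ++ t) ->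
  exists w1 w2, [/\ w = w1 ++ w2, subseq (unzip1 w1) s & subseq (unzip1 w2) t].
Proof.
elim: s w => [|x s IHs] w; first by exists [::], w.
case: w => [|[y u] w] /=; first by exists [::], [::]; rewrite !sub0seq.
case: eqP => [->|ne] wst.
  by have [w1 [w2 [-> s1 s2]]] := IHs w wst; exists ((x, u) :: w1), w2; rewrite /= eqxx.
have [w1 [w2 [e s1 s2]]] := IHs ((y, u) :: w) wst.
exists w1, w2; split=> //; exact: subseq_trans s1 (subseq_cons _ _).
Qed.

Lemma alternating_count (b : bool) (t : seq bool) :
  sorted neqb t -> size t <= (count_mem b t).*2.+1.
Proof.
have path_count a s : path neqb a s -> size s <= (count_mem b s).*2 + (a == b).
  elim: s a => //= c s IHs a /andP[ac /IHs{IHs}]; case: a b c ac => [] [] [] //=; lia.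
case: t => //= a t /path_count; case: (a == b) => /=; lia.
Qed.

Lemma alternating_nth (t : seq bool) i : sorted neqb t -> i < size t ->
  nth false t i = nth false t 0 (+) odd i.
Proof.
elim: i t => [|i IHi] [|a t] //=; rewrite ?addbF // => at_ ilt.
rewrite IHi ?(path_sorted at_) //; case: t at_ ilt => //= c t /andP[];
  case: a c => [] []; by rewrite ?addbN ?addNb //; case: (odd i).
Qed.

(** Here [cP b] and [cQ b] are the rows and the columns that cover the cells of
    sign [b]. *)
Section Snake.
Variables (P Q : eqType) (cP : bool -> pred P) (cQ : bool -> pred Q).
Implicit Types (w : seq ((P * Q) * bool)) (W : seq Q).

Definition signed_cover w :=
  sorted (fun u v => u.2 != v.2) w && all (fun u => cP u.2 u.1.1 || cQ u.2 u.1.2) w.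

Lemma signed_cover_cat w1 w2 : signed_cover (w1 ++ w2)
  -> signed_cover w1 /\ signed_cover w2.
Proof.
by move=> /andP[/cat_sorted2[s1 s2]]; rewrite all_cat => /andP[a1 a2];
  rewrite /signed_cover s1 s2 a1 a2.
Qed.

Lemma signed_cover_sorted w : signed_cover w -> sorted neqb (unzip2 w).
Proof. by move=> /andP[sw _]; rewrite sorted_map. Qed.

Lemma signed_cover_mem w x b : signed_cover w -> (x, b) \in w -> cP b x.1 || cQ b x.2.
Proof. by move=> /andP[_ /allP h] /h. Qed.

Lemma signed_cover_split w s t : signed_cover w -> subseq (unzip1 w) (s ++ t) ->
  exists w1 w2, [/\ w = w1 ++ w2, signed_cover w1 /\ signed_cover w2,
    subseq (unzip1 w1) s & subseq (unzip1 w2) t].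
Proof.
move=> sw /subseq_unzip1_cat[w1 [w2 [wE s1 s2]]]; exists w1, w2; split=> //.
by apply: signed_cover_cat; rewrite -wE.
Qed.

Definition line (p : P) W : seq (P * Q) := [seq (p, q) | q <- W].

Definition either (T : Type) (c : bool -> pred T) : pred T
  := fun x => c true x || c false x.
Definition both (T : Type) (c : bool -> pred T) : pred T
  := fun x => c true x && c false x.

Definition exactly_one (T : Type) (c : bool -> pred T) : pred T
  := fun x => c true x != c false x.

Lemma eitherP (T : Type) (c : bool -> pred T) b x : c b x -> either c x.
Proof. by rewrite /either; case: b => ->; rewrite ?orbT. Qed.

Lemma line_either p W w : ~~ either cP p -> signed_cover w ->
  subseq (unzip1 w) (line p W) -> subseq (unzip1 w) (line p (filter (either cQ) W)).
Proof.
move=> np sw wW; suff -> : line p (filter (either cQ) W) =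
    filter (fun x => either cQ x.2) (line p W).
  rewrite subseq_filter wW andbT; apply/allP => _ /mapP[[x b] xw ->].
  have /mapP[q _ xE] := mem_subseq wW (map_f fst xw).
  have /orP[cp|] := signed_cover_mem sw xw; last exact: eitherP.
  by rewrite [x]xE in cp; rewrite (eitherP cp) in np.
by rewrite /line filter_map.
Qed.

(** If the line covers one sign only, the terms of the other sign lie in crossing
    lines that cover that sign; at most [K] of them separate the remaining
    terms. *)
Lemma line_bound K p W w : (forall b, count (cQ b) W <= K) -> signed_cover w ->
  subseq (unzip1 w) (line p W) ->
  size w <= both cP p * size W + exactly_one cP p * K.*2.+1 + count (either cQ) W.
Proof.
move=> cK sw wW; have sizew : size w = size (unzip1 w) by rewrite size_map.
have [bp|nbp] := boolP (both cP p).
  rewrite mul1n -addnA; apply: leq_trans (leq_addr _ _).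
  by rewrite sizew -(size_map (pair p) W); apply: size_subseq.
have [op|nop] := boolP (exactly_one cP p); last first.
  rewrite !mul0n !add0n sizew -size_filter -(size_map (pair p) (filter _ _)).
  apply/size_subseq/line_either => //.
  by move: nbp nop; rewrite /both /exactly_one /either; case: cP; case: cP.
have [b cb ncb] : exists2 b, cP b p & ~~ cP (~~ b) p.
  by move: op; rewrite /exactly_one; case t: (cP true p); case f: (cP false p) => // _;
    [exists true | exists false]; rewrite ?t ?f.
rewrite mul0n add0n mul1n; apply: leq_trans (leq_addr _ _).
rewrite -(size_map snd);
  apply: leq_trans (alternating_count (~~ b) (signed_cover_sorted sw)) _.
rewrite ltnS leq_double; apply: leq_trans (cK (~~ b)).
rewrite count_map -!size_filter -(size_map (fun u => u.1.2)).
apply: size_subseq; rewrite subseq_filter; apply/andP; split.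
  apply/allP => _ /mapP[[x c] + ->]; rewrite mem_filter /= => /andP[/eqP -> xw].
  have /mapP[q _ xE] := mem_subseq wW (map_f fst xw).
  by have := signed_cover_mem sw xw; rewrite [x]xE /= (negPf ncb).
have -> : W = map snd (line p W) by rewrite -map_comp map_id.
rewrite map_comp; apply: map_subseq; apply: subseq_trans wW.
exact/map_subseq/filter_subseq.
Qed.

(** The cells of the two lines that lie on covering columns form a palindrome of
    columns.  If all of them were used, the two cells of a one-signed column
    would have the same sign, although an even number of terms lies between
    them. *)
Lemma turn_bound p p' W w : uniq W -> ~~ either cP p -> ~~ either cP p' ->
  has (exactly_one cQ) W -> signed_cover w ->
  subseq (unzip1 w) (line p W ++ line p' (rev W)) ->
  size w < (count (either cQ) W).*2.
Proof.
move=> uW np np' /hasP[q0 q0W q0d] sw wl.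
have [w1 [w2 [wE [sw1 sw2] s1 s2]]] := signed_cover_split sw wl.
have {}s1 := line_either np sw1 s1; have {}s2 := line_either np' sw2 s2.
set W' := filter (either cQ) W in s1; rewrite filter_rev -/W' in s2.
rewrite -size_filter -/W' -addnn.
have le1 : size w1 <= size W' by have := size_subseq s1; rewrite !size_map.
have le2 : size w2 <= size W' by have := size_subseq s2; rewrite !size_map size_rev.
rewrite ltn_neqAle {2}wE size_cat leq_add // andbT; apply/eqP => sizew.
have [eq1 eq2] : size w1 = size W' /\ size w2 = size W'.
  by move: sizew le1 le2; rewrite wE size_cat; clear; lia.
have {}s1 : unzip1 w1 = line p W' by apply/eqP;
  rewrite -(size_subseq_leqif s1).2 !size_map eq1.
have {}s2 : unzip1 w2 = line p' (rev W').
  by apply/eqP; rewrite -(size_subseq_leqif s2).2 !size_map size_rev eq2.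
have [b cb ncb] : exists2 b, cQ b q0 & ~~ cQ (~~ b) q0.
  by move: q0d; rewrite /exactly_one; case t: (cQ true q0); case f: (cQ false q0) => // _;
    [exists true | exists false]; rewrite ?t ?f.
have q0W' : q0 \in W' by rewrite mem_filter q0W (eitherP cb).
have cover_sign x c : ~~ either cP x.1 -> x.2 = q0 -> (x, c) \in w -> c = b.
  move=> nx xq xw; have := signed_cover_mem sw xw; rewrite xq => /orP[cx|].
    by rewrite (eitherP cx) in nx.
  by move=> cc; case: b c cc ncb {cb xw} => [] [] //= ->.
pose k := size W'; pose i := index q0 W'.
have ik : i < k by rewrite index_mem.
pose u0 := ((p, q0), false).
have fstw : unzip1 w = line p W' ++ line p' (rev W')
  by rewrite wE /unzip1 map_cat -!/(unzip1 _) s1 s2.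
have sign_at j x : j < size w -> nth (p, q0) (unzip1 w) j = x -> ~~ either cP x.1
  -> x.2 = q0 ->
    nth false (unzip2 w) j = b.
  move=> jw; rewrite (nth_map u0) // (nth_map u0) // => ex nx xq.
  by apply: (cover_sign x) => //; rewrite -ex -surjective_pairing mem_nth.
have ki : k.*2 - i.+1 < size w.
  by rewrite sizew addnn -/k ltn_subrL double_gt0 (leq_ltn_trans (leq0n i) ik).
have iw : i < size w by rewrite sizew ltn_addl.
have b1 : nth false (unzip2 w) i = b.
  apply: (sign_at i (p, q0)) => //; rewrite fstw nth_cat size_map ik.
  by rewrite (nth_map q0) // nth_index.
have b2 : nth false (unzip2 w) (k.*2 - i.+1) = b.
  apply: (sign_at _ (p', q0)) => //; rewrite fstw nth_cat size_map -/k.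
  have -> : (k.*2 - i.+1 < k) = false by apply/negbTE; move: ik; clear; lia.
  have -> : k.*2 - i.+1 - k = k - i.+1 by move: ik; clear; lia.
  have kik : k - i.+1 < k by rewrite ltn_subrL (leq_ltn_trans (leq0n i) ik).
  by rewrite (nth_map q0) ?size_rev // nth_rev // subnSK // subKn ?nth_index // ltnW.
have sgn := signed_cover_sorted sw.
have size2 : size (unzip2 w) = size w by rewrite size_map.
move: b1 b2; rewrite (@alternating_nth _ i sgn) ?size2 //.
rewrite (@alternating_nth _ (k.*2 - i.+1) sgn) ?size2 //.
rewrite oddB; last by move: ik; clear; lia.
by rewrite odd_double /=; move: (nth _ _ 0); clear; case: b => [] []; case: (odd i).
Qed.

Fixpoint snake (l : seq P) (W : seq Q) : seq (P * Q) :=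
  match l with
  | p :: p' :: l' => (line p W ++ line p' (rev W)) ++ snake l' W
  | [:: p] => line p W
  | [::] => [::]
  end.

(** The gain of one term for each pair of consecutive lines is counted for all
    pairs; the pairs that contain a covering line give it back through the terms
    [K.*2.+2], instead of [K.*2.+1], and [count (both cP) l * has _ _]. *)
Lemma snake_bound K l W w : uniq W -> (forall b, count (cQ b) W <= K) -> signed_cover w ->
  subseq (unzip1 w) (snake l W) ->
  size w + has (exactly_one cQ) W * (size l)./2
    <= count (both cP) l * size W + count (exactly_one cP) l * K.*2.+2
       + count (both cP) l * has (exactly_one cQ) W + size l * count (either cQ) W.
Proof.
move=> uW cK; have [N] := ubnP (size l); elim: N l w => // N IHN [|p [|p' l]] w lN sw wl.
- by have := size_subseq wl; rewrite /= size_map leqn0 => /eqP ->; rewrite muln0.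
- have := line_bound cK sw wl; rewrite /= muln0 !addn0 mul1n => /leq_trans; apply.
  rewrite leq_add2r -addnA leq_add2l; apply: leq_trans (leq_addr _ _).
  by rewrite leq_mul2l leqnSn orbT.
have [w1 [w2 [wE [sw1 sw2] s1 s2]]] := signed_cover_split sw wl.
have := IHN l w2 (leq_trans (ltnW (ltnSn _)) lN) sw2 s2.
have cKr b : count (cQ b) (rev W) <= K by rewrite count_rev.
have [w3 [w4 [w1E [sw3 sw4] s3 s4]]] := signed_cover_split sw1 s1.
have := line_bound cK sw3 s3; have := line_bound cKr sw4 s4.
rewrite size_rev count_rev.
have turn : ~~ either cP p -> ~~ either cP p' ->
    has (exactly_one cQ) W -> size w1 < (count (either cQ) W).*2.
  by move=> np np' hW; apply: (turn_bound uW np np' hW sw1 s1).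
move: turn; rewrite wE w1E !size_cat /=.
move: (has _ W) (count _ W) (count (both cP) l) (count (exactly_one cP) l) => h c cb cd.
rewrite /either /both /exactly_one.
move: (cP true p) (cP false p) (cP true p') (cP false p') => a b a' b' turn le4 le3.
have pay (u v : bool) : (u && v) * size W + (u != v) * K.*2.+1 + (u || v) * h
    <= (u && v) * size W + (u != v) * K.*2.+2 + (u && v) * h.
  by case: u v => [] []; rewrite ?mul1n ?mul0n ?add0n ?addn0 //; case: (h);
    rewrite ?addn0 ?addn1 // leqW.
have le1 : size w3 + size w4 + h <= (a && b) * size W + (a' && b') * size W
    + ((a != b) * K.*2.+2 + (a' != b') * K.*2.+2)
    + ((a && b) * h + (a' && b') * h) + c.*2.
  have [|free] := boolP ((a || b) || (a' || b')).
    move: le3 le4 (pay a b) (pay a' b').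
    move: ((a && b) * _) ((a && b) * _) ((a != b) * _) ((a != b) * _) => x1 x2 x3 x4.
    move: ((a' && b') * _) ((a' && b') * _) ((a' != b') * _) ((a' != b') * _)
      => y1 y2 y3 y4.
    by clear; case: (a || b) (a' || b') => [] [] //; rewrite ?mul1n ?mul0n; lia.
  move: free; rewrite negb_or => /andP[/norP[na nb] /norP[na' nb']].
  move: le3 le4 turn; rewrite (negPf na) (negPf nb) (negPf na') (negPf nb') /=.
  move: (size w3) (size w4) => x y.
  by clear; case: h => /= le3 le4 turn; [have := turn isT isT isT|]; lia.
rewrite [h * _.+1]mulnS.
rewrite !mulnDl !mulSn; move: le1.
move: (h * _) (size l * c) (cb * _) (cd * K.*2.+2) (cb * h) => x1 x2 x3 x4 x5.
move: ((a && b) * _) ((a' && b') * _) ((a != b) * _) ((a' != b') * _) => y1 y2 y3 y4.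
move: ((a && b) * _) ((a' && b') * _) => y5 y6.
by clear; lia.
Qed.

Lemma mem_snake l W x : (x \in snake l W) = (x.1 \in l) && (x.2 \in W).
Proof.
have mem_line p V : (x \in line p V) = (x.1 == p) && (x.2 \in V).
  by case: x => x y; apply/mapP/andP => /= [[q qV [-> ->]]|[/eqP -> yV]];
    [rewrite eqxx | exists y].
have [N] := ubnP (size l); elim: N l => // N IHN [|p [|p' l]] lN.
- by [].
- by rewrite mem_line mem_seq1.
have -> : snake [:: p, p' & l] W = (line p W ++ line p' (rev W)) ++ snake l W by [].
rewrite !mem_cat !mem_line mem_rev IHN; last exact: leq_trans (ltnW (ltnSn _)) lN.
by rewrite !inE !andb_orl orbA.
Qed.

Lemma size_snake l W : size (snake l W) = size l * size W.
Proof.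
have [N] := ubnP (size l); elim: N l => // N IHN [|p [|p' l]] lN.
- by [].
- by rewrite size_map mul1n.
have -> : snake [:: p, p' & l] W = (line p W ++ line p' (rev W)) ++ snake l W by [].
rewrite !size_cat !size_map size_rev IHN; last exact: leq_trans (ltnW (ltnSn _)) lN.
by rewrite [size [:: p, p' & l]]/= !mulSn addnA.
Qed.

End Snake.

(** * The ordering of the grid *)

Lemma subset_of_card (T : finType) (A : {set T}) k :
  k <= #|A| -> exists2 B : {set T}, B \subset A & #|B| = k.
Proof.
move=> kA; exists [set x in take k (enum A)].
  by apply/subsetP => x; rewrite inE => /mem_take; rewrite mem_enum.
rewrite cardsE; have /card_uniqP -> : uniq (take k (enum A))
  by rewrite take_uniq ?enum_uniq.
by rewrite size_takel // -cardE.
Qed.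

Section Order.
Variables m n : nat.

Definition low N : seq 'I_N := take N./2 (enum 'I_N).
Definition high N : seq 'I_N := drop N./2 (enum 'I_N).

Lemma low_high N (i : 'I_N) : (i \in low N) || (i \in high N).
Proof. by rewrite -mem_cat cat_take_drop mem_enum. Qed.

Lemma half_le N : N./2 <= N. Proof.
  by rewrite -[leqRHS]odd_double_half -addnn addnA leq_addl. Qed.

Lemma size_low N : size (low N) = N./2.
Proof. by rewrite size_takel // size_enum_ord half_le. Qed.

Lemma size_high N : size (high N) = N - N./2.
Proof. by rewrite size_drop size_enum_ord. Qed.

Definition swap (T U : Type) (x : T * U) : U * T := (x.2, x.1).

Lemma swap_inj (T U : Type) : injective (@swap T U).
Proof. by move=> [x y] [x' y'] [-> ->]. Qed.

(** Every row is read lengthwise in one half of the columns and is crossed by the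
    lines read in the other half, and likewise for columns: each line is met
    about half as many times as it has cells. *)
Definition grid_order : seq ('I_m * 'I_n) :=
  (snake (low m) (low n) ++ snake (high m) (high n))
  ++ (map (@swap _ _) (snake (low n) (high m)) ++ map (@swap _ _) (snake (high n) (low m))).

Lemma size_grid_order : size grid_order = m * n.
Proof.
rewrite !size_cat !size_map !size_snake !size_low !size_high.
move: (subnKC (half_le m)) (subnKC (half_le n)).
move: m./2 n./2 (m - m./2) (n - n./2).
by move=> a b c d <- <-; rewrite !mulnDl !mulnDr [d * a]mulnC [b * c]mulnC; clear; lia.
Qed.

Lemma mem_grid_order x : x \in grid_order.
Proof.
have [y ->] : exists y, x = swap y by exists (swap x); case: x.
rewrite !mem_cat !(mem_map (@swap_inj _ _)) !mem_snake /=.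
have := low_high y.2; have := low_high y.1.
by do 4!case: (_ \in _).
Qed.

Lemma uniq_grid_order : uniq grid_order.
Proof.
apply: (@leq_size_uniq _ (enum {: 'I_m * 'I_n})) => [|x _|]; first exact: enum_uniq.
  exact: mem_grid_order.
by rewrite size_grid_order -cardE card_prod !card_ord.
Qed.

Lemma uniq_low N : uniq (low N). Proof. by rewrite take_uniq ?enum_uniq. Qed.
Lemma uniq_high N : uniq (high N). Proof. by rewrite drop_uniq ?enum_uniq. Qed.

End Order.

Lemma count_low_high N (a : pred 'I_N) : count a (low N) + count a (high N) = #|a|.
Proof. by rewrite -count_cat cat_take_drop enumT -size_filter cardE. Qed.

(** * The counting argument *)

(** In this summary of the four quadrants, [gI1] is the number of low rows that
    cover both signs, [dI1] that of the low rows that cover one sign, and so on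
    with [2] for the high ones and [J] for the columns.  The products with [g]
    add up to [g * n] for rows and [g * m] for columns, and those with [d] to
    about half of that; [loss] is the lower bound on the gain of the turns that
    beats the remaining quadratic terms in [k]. *)
Lemma grid_arith k m n gI1 gI2 gJ1 gJ2 dI1 dI2 dJ1 dJ2 s1 s2 s3 s4 :
  n <= m -> 16 * k ^ 2 + 36 * k + 3 <= m ->
  (gI1 + gI2 + gJ1 + gJ2).*2 + (dI1 + dI2 + dJ1 + dJ2) <= k.*2 ->
  s1 + (0 < dJ1) * m./2./2
    <= gI1 * n./2 + dI1 * k.*2.+2 + gI1 * (0 < dJ1) + m./2 * (gJ1 + dJ1) ->
  s2 + (0 < dJ2) * (m - m./2)./2
    <= gI2 * (n - n./2) + dI2 * k.*2.+2 + gI2 * (0 < dJ2) + (m - m./2) * (gJ2 + dJ2) ->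
  s3 + (0 < dI2) * n./2./2
    <= gJ1 * (m - m./2) + dJ1 * k.*2.+2 + gJ1 * (0 < dI2) + n./2 * (gI2 + dI2) ->
  s4 + (0 < dI1) * (n - n./2)./2
    <= gJ2 * m./2 + dJ2 * k.*2.+2 + gJ2 * (0 < dI1) + (n - n./2) * (gI1 + dI1) ->
  s1 + s2 + s3 + s4 <= k * m.
Proof.
move=> nm mk gd b1 b2 b3 b4.
pose G := gI1 + gI2 + gJ1 + gJ2; pose d := dI1 + dI2 + dJ1 + dJ2.
have [d0|d_gt0] := posnP d.
  have [z1 [z2 [z3 z4]]] : dI1 = 0 /\ dI2 = 0 /\ dJ1 = 0 /\ dJ2 = 0.
    by move: d0; rewrite /d; clear; lia.
  have Gk : G * m <= k * m by rewrite leq_mul //; move: gd; rewrite /G; clear; lia.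
  have Gn : (gI1 + gI2) * n <= (gI1 + gI2) * m by rewrite leq_mul2l nm orbT.
  move: b1 b2 b3 b4 Gk Gn; rewrite z1 z2 z3 z4 /G /= !muln0 !addn0.
  have mE := subnKC (half_le m); have nE := subnKC (half_le n).
  move: m./2 (m - m./2) n./2 (n - n./2) mE nE => m1 m2 n1 n2 <- <-.
  by rewrite !mulnDr !mulnDl; clear; lia.
have h_le (g x : nat) : g * (0 < x) <= g by rewrite -[leqRHS]muln1 leq_mul2l leq_b1 orbT.
have half2 (N x : nat) : (N./2 * x).*2 <= N * x.
  by rewrite doubleMl leq_mul // -[leqRHS]odd_double_half leq_addl.
have uhalf2 (N x : nat) : ((N - N./2) * x).*2 <= N * x + x.
  by rewrite doubleMl addnC -mulSn leq_mul //; clear; lia.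
have dk : d * k.*2.+2 <= k.*2 * k.*2.+2 by rewrite leq_mul //; move: gd; rewrite -/d;
  clear; lia.
have total : (G.*2 + d) * m <= k.*2 * m by rewrite leq_mul2r gd orbT.
have ns : n + (m - n) = m by rewrite subnKC.
have loss : m <= 4 * ((0 < dJ1) * m./2./2 + (0 < dJ2) * (m - m./2)./2
    + (0 < dI2) * n./2./2 + (0 < dI1) * (n - n./2)./2) + 2 * ((dI1 + dI2) * (m - n)) + 3.
  have [J0|] := posnP (dJ1 + dJ2).
    have : m - n <= (dI1 + dI2) * (m - n).
      by rewrite -[X in X <= _]mul1n leq_mul //; move: d_gt0 J0; rewrite /d; clear; lia.
    have : (0 < dI2) || (0 < dI1) by move: d_gt0 J0; rewrite /d; clear; lia.
    move: ns; move: (_ * (m - n)) => x; by case: (0 < dI1) (0 < dI2) => [] [] //;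
      rewrite ?mul1n ?mul0n; clear; lia.
  rewrite addn_gt0; move: (_ * (m - n)) ((0 < dI2) * _) ((0 < dI1) * _) => x y z.
  by case: (0 < dJ1) (0 < dJ2) => [] [] // _; rewrite ?mul1n ?mul0n; clear; lia.
move: (half2 m dJ1) (uhalf2 m dJ2) (half2 n dI2) (uhalf2 n dI1).
move: (h_le gI1 dJ1) (h_le gI2 dJ2) (h_le gJ1 dI2) (h_le gJ2 dI1).
move: loss b1 b2 b3 b4.
rewrite !mulnDl !mulnDr.
move: ((0 < dJ1) * _) ((0 < dJ2) * _) ((0 < dI2) * _) ((0 < dI1) * _) => l1 l2 l3 l4.
move: (gI1 * (0 < _)) (gI2 * (0 < _)) (gJ1 * (0 < _)) (gJ2 * (0 < _)) => h1 h2 h3 h4.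
have split (g a N : nat) : a <= N -> g * a + g * (N - a) = g * N.
  by move=> aN; rewrite -mulnDr subnKC.
move: (split gI1 _ _ (half_le n)) (split gI2 _ _ (half_le n)).
move: (split gJ1 _ _ (half_le m)) (split gJ2 _ _ (half_le m)).
move: (split dI1 _ _ nm) (split dI2 _ _ nm) (leq_mul (leqnn gI1) nm) (leq_mul (leqnn gI2) nm).
move: total dk gd mk; rewrite /G /d; move: m./2 (m - m./2) n./2 (n - n./2) (m - n).
clear; move=> m1 m2 n1 n2 t; lia.
Qed.

Lemma count_exactly_one (T : Type) (c : bool -> pred T) s :
  (count (both c) s).*2 + count (exactly_one c) s = count (c true) s + count (c false) s.
Proof.
elim: s => //= x s; rewrite /both /exactly_one.
by case: (c true x) (c false x) => [] [] /=; clear; lia.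
Qed.

Lemma count_either (T : Type) (c : bool -> pred T) s :
  count (either c) s = count (both c) s + count (exactly_one c) s.
Proof.
elim: s => //= x s ->; rewrite /both /exactly_one /either.
by case: (c true x) (c false x) => [] [] /=; clear; lia.
Qed.

Lemma signed_cover_swap (P Q : eqType) (cP : bool -> pred P) (cQ : bool -> pred Q) w s :
  signed_cover cP cQ w -> subseq (unzip1 w) (map (@swap Q P) s) ->
  exists w', [/\ signed_cover cQ cP w', size w' = size w & subseq (unzip1 w') s].
Proof.
move=> /andP[sw aw] ws; exists [seq (swap u.1, u.2) | u <- w]; split.
- rewrite /signed_cover sorted_map all_map sw /=.
  by apply: sub_all aw => u /=; rewrite orbC.
- exact: size_map.
- have -> : s = map (@swap P Q) (map (@swap Q P) s) by rewrite mapK // => -[].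
  by rewrite /unzip1 -map_comp (map_comp (@swap P Q) fst); apply: map_subseq.
Qed.

Lemma card_inl_inr (P Q : finType) (W : {set P + Q}) :
  #|[pred p | inl p \in W]| + #|[pred q | inr q \in W]| <= #|W|.
Proof.
rewrite -[X in X + _]cardsE -[X in _ + X]cardsE.
rewrite -(card_imset _ (@inl_inj P Q)) -(card_imset _ (@inr_inj P Q)).
rewrite -cardsUI (_ : _ :&: _ = set0) ?cards0 ?addn0.
  apply/subset_leq_card/subsetP => v /setUP[] /imsetP[x + ->];
  by rewrite inE.
by apply/setP => v; rewrite !inE; apply/negP => /andP[/imsetP[p _ ->] /imsetP[]].
Qed.

Section GridBound.
Variables (m n k : nat) (W : bool -> {set 'I_m + 'I_n}).
Hypotheses (nm : n <= m) (mk : 16 * k ^ 2 + 36 * k + 3 <= m).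
Hypothesis Wk : forall b, #|W b| <= k.

Let cP b := [pred i : 'I_m | inl i \in W b].
Let cQ b := [pred j : 'I_n | inr j \in W b].

Lemma grid_bound w :
  signed_cover cP cQ w -> subseq (unzip1 w) (grid_order m n) -> size w <= k * m.
Proof.
move=> sw /(signed_cover_split sw)[w12 [w34 [-> [sw12 sw34]]]].
move=> /(signed_cover_split sw12)[w1 [w2 [-> [sw1 sw2] o1 o2]]].
move=> /(signed_cover_split sw34)[w3 [w4 [-> [sw3 sw4] o3 o4]]].
rewrite !size_cat addnA.
have [{}w3 [{}sw3 <- {}o3]] := signed_cover_swap sw3 o3.
have [{}w4 [{}sw4 <- {}o4]] := signed_cover_swap sw4 o4.
have cPk b : count (cP b) (low m) + count (cP b) (high m)
  + (count (cQ b) (low n) + count (cQ b) (high n)) <= k.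
  by rewrite !count_low_high; apply: leq_trans (card_inl_inr _) (Wk b).
have cPl b : count (cP b) (low m) <= k by apply: leq_trans (cPk b);
  rewrite -addnA leq_addr.
have cPh b : count (cP b) (high m) <= k.
  by apply: leq_trans (cPk b); rewrite -addnA addnCA leq_addr.
have cQl b : count (cQ b) (low n) <= k.
  by apply: leq_trans (cPk b); rewrite addnCA leq_addr.
have cQh b : count (cQ b) (high n) <= k.
  by apply: leq_trans (cPk b); rewrite addnA leq_addl.
have := snake_bound (uniq_low n) cQl sw1 o1.
have := snake_bound (uniq_high n) cQh sw2 o2.
have := snake_bound (uniq_high m) cPh sw3 o3.
have := snake_bound (uniq_low m) cPl sw4 o4.
rewrite !has_count !size_low !size_high !count_either => b4 b3 b2 b1.
apply: (grid_arith nm mk _ b1 b2 b3 b4).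
have := cPk true; have := cPk false.
have := count_exactly_one cP (low m); have := count_exactly_one cP (high m).
have := count_exactly_one cQ (low n); have := count_exactly_one cQ (high n).
move: (count (both cP) _) (count (both cP) _) (count (both cQ) _) (count (both cQ) _).
move: (count (exactly_one cP) _) (count (exactly_one cP) _).
move: (count (exactly_one cQ) _) (count (exactly_one cQ) _).
move: (count (cP true) _) (count (cP true) _) (count (cQ true) _) (count (cQ true) _).
move: (count (cP false) _) (count (cP false) _) (count (cQ false) _) (count (cQ false) _).
by clear; lia.
Qed.

End GridBound.

(** By Konig's theorem the cells of each sign have a cover by [r.-1] lines, and an
    optimal alternating subsequence is signed accordingly. *)
Lemma rook_alt_ord m n r (r0 : 0 < r)
    (sigma : #|rook_hypergraph m n r0|.-tuple (rook_hypergraph m n r0)) :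
  n <= m -> 16 * r.-1 ^ 2 + 36 * r.-1 + 3 <= m ->
  tval sigma = grid_order m n -> alt_ord sigma <= r.-1 * m.
Proof.
move=> nm mr sigmaE; have us : uniq sigma by rewrite sigmaE uniq_grid_order.
apply/bigmax_leqP => X /andP[noplus nominus].
have cover b : exists2 W : {set 'I_m + 'I_n},
    covers (sign_class sigma X (Some b)) W & #|W| <= r.-1.
  have noH : ~~ contains_hyperedge (sign_class sigma X (Some b)) by case: b.
  have [/existsP[W /andP[/forall_inP cW Wr]]|noW] :=
    boolP [exists W : {set 'I_m + 'I_n}, [forall x in sign_class sigma X (Some b),
      (inl x.1 \in W) || (inr x.2 \in W)] && (#|W| <= r.-1)].
    by exists W.
  case/negP: noH.
  have [|M [ME indM /subset_of_card[B BM cB]]]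
    := @konig _ _ (sign_class sigma X (Some b)) r.
    move=> W cW; rewrite leqNgt; apply: contra noW => Wr; apply/existsP; exists W.
    by rewrite -ltnS prednK // Wr andbT; apply/forall_inP.
  apply/existsP; exists B; rewrite (subset_trans BM ME) andbT inE cB eqxx andbT.
  by apply/rook_setP => x y xB yB; apply: indM; apply: (subsetP BM).
have [W1 cW1 W1r] := cover true; have [W0 cW0 W0r] := cover false.
pose W b := if b then W1 else W0.
have [w [/andP[allw sw] /subseqP[b sb wE] <-]] := alt_witness X.
pose v := [seq (u.1, odflt true u.2) | u <- mask b (zip sigma X)].
have szX : size sigma = size X by rewrite !size_tuple.
have mask2 : map snd (mask b (zip sigma X)) = w.
  by rewrite wE map_mask -/(unzip2 _) unzip2_zip ?szX.
have some2 u : u \in mask b (zip sigma X) -> u.2 = Some (odflt true u.2).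
  move=> uv; have : isSome u.2 by apply: (allP allw); rewrite -mask2 map_f.
  by case: (u.2).
have v2 : map (fun u => Some u.2) v = w.
  by rewrite -mask2 -map_comp; apply/eq_in_map => u /some2.
have <- : size v = size w by rewrite -v2 [RHS]size_map.
apply: (grid_bound (W := W) nm mr); first by case.
  apply/andP; split; first by rewrite -v2 sorted_map in sw.
  apply/allP => _ /mapP[u uv ->] /=; have := some2 u uv.
  have /(nthP (u.1, None))[i] := mem_mask uv.
  rewrite size_zip szX minnn size_tuple nth_zip // => iN uE u2.
  suff : u.1 \in sign_class sigma X (Some (odflt true u.2)).
    by case: (odflt true u.2) => uX; [apply: cW1 | apply: cW0].
  apply/imsetP; exists (Ordinal iN); last by rewrite (tnth_nth u.1) -[LHS](congr1 fst uE).
  by rewrite inE (tnth_nth None) -u2 -(congr1 snd uE).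
rewrite /v /unzip1 -map_comp -sigmaE.
have -> :
    [seq (fst \o (fun u : 'I_m * 'I_n * sign => (u.1, odflt true u.2))) i
    | i <- mask b (zip sigma X)]
  = mask b (unzip1 (zip sigma X)) by rewrite /unzip1 map_mask.
by rewrite unzip1_zip ?szX // mask_subseq.
Qed.

Theorem corollary4 :
  forall r : nat, 0 < r ->
  exists m0 : nat, forall m n : nat, m0 <= m -> n <= m -> r <= n ->
    chromatic_number (matching_kneser (complete_bipartite m n) r)
      = m * (n - r + 1) /\
    is_altermatic_number (matching_kneser (complete_bipartite m n) r)
      (m * (n - r + 1)).
Proof.
move=> r r0; exists (16 * r.-1 ^ 2 + 36 * r.-1 + 3) => m n mr nm rn.
set F := matching_kneser _ r; pose H := rook_hypergraph m n r0.
have [HF FH] : hom_equiv (KG H) F := rook_hom_equiv m n r0.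
have colF : colorable F (m * (n - r + 1))
  := colorable_hom FH (@rook_colorable m n r r0 rn).
have cardH : #|H| = m * n by rewrite card_prod !card_ord.
have altH : m * (n - r + 1) <= #|H| - alt_hyp H.
  have szo : size (grid_order m n) == #|H| by rewrite size_grid_order cardH.
  have := @rook_alt_ord m n r r0 (Tuple szo) nm mr erefl.
  move=> /(leq_trans (@alt_hyp_le H (Tuple szo) (uniq_grid_order m n))) altm.
  have -> : m * (n - r + 1) = #|H| - r.-1 * m.
    rewrite cardH [r.-1 * m]mulnC -mulnBr; congr (_ * _).
    by move: (r0) rn; clear; lia.
  exact: leq_sub2l.
split.
  rewrite /chromatic_number; case: ex_minnP => c colc cmin; apply/eqP.
  by rewrite eqn_leq cmin //= (leq_trans altH) // (altermatic_bound HF).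
split=> [|G [GF _]]; last exact: altermatic_bound GF colF.
exists H; split; first by split.
by apply/eqP; rewrite eqn_leq altH (altermatic_bound HF).
Qed.
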